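(* Let $d\ge 1$ be an integer. If $\delta\in(0,1)$, then the normalized Lebesgue surface measure $\sigma$ on $\mathbb{S}^d$ is the unique maximizer of $I_{d,\delta}(\mu)$ over all $\mu\in\mathcal{B}$. If $-d<\delta\le 0$, then $\sigma$ is the unique minimizer of $I_{d,\delta}(\mu)$ over all $\mu\in\mathcal{B}$.
   Context: $\mathbb{S}^d\subset\mathbb{R}^{d+1}$ is the unit sphere; $\mathcal{B}$ is the set of all Borel probability measures on $\mathbb{S}^d$; $\sigma$ is the surface Lebesgue measure on $\mathbb{S}^d$ normalized by $\sigma(\mathbb{S}^d)=1$. For $t\in[-1,1]$ put $F_\delta(t)=(\arccos t)^\delta$ if $\delta\neq 0$, and $F_0(t)=\log\left(\frac{\pi}{\arccos t}\right)$ (for $\delta\le 0$ the value at $t=1$ is $+\infty$). The geodesic distance energy integral of $\mu\in\mathcal{B}$ is $$I_{d,\delta}(\mu)=\int_{\mathbb{S}^d}\int_{\mathbb{S}^d}F_\delta(x\cdot y)\,d\mu(x)\,d\mu(y),$$ which may equal $+\infty$ when $\delta\le 0$. Here $\arccos(x\cdot y)=\rho(x,y)$ is the geodesic distance on $\mathbb{S}^d$. *)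

(* Defs.v *)
From HB Require Import structures.
From mathcomp Require Import all_boot all_order all_algebra.
From mathcomp Require Import all_classical all_reals all_analysis.
From mathcomp Require Import ring lra.

Set Implicit Arguments.
Unset Strict Implicit.
Unset Printing Implicit Defensive.

Import Order.TTheory GRing.Theory Num.Theory.
Import numFieldNormedType.Exports.

Local Open Scope classical_set_scope.
Local Open Scope ring_scope.

Definition dotrv (R : realType) (n : nat) (x y : 'rV[R]_n) : R :=
  \sum_(i < n) x 0 i * y 0 i.

Definition borel_rV (R : realType) (n : nat) :=
  g_sigma_algebraType (@open 'rV[R]_n).

Definition sphere_set (R : realType) (d : nat) : set 'rV[R]_d.+1 :=
  [set x | dotrv x x = 1].

(* [set_type] carries the topology induced by the inclusion. *)
Definition sphere (R : realType) (d : nat) := set_type (@sphere_set R d).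

Lemma sphere_point_subproof (R : realType) (d : nat) :
  delta_mx 0 0 \in @sphere_set R d.
Proof.
rewrite inE /sphere_set /= /dotrv (bigD1 ord0)//= big1 ?addr0.
  by rewrite mxE !eqxx mulr1.
by move=> i /negbTE i0; rewrite mxE i0 andbF mul0r.
Qed.

Section sphere_instances.
Variables (R : realType) (d : nat).

HB.instance Definition _ := Topological.copy (sphere R d)
  (set_type (@sphere_set R d)).
HB.instance Definition _ := isPointed.Build (sphere R d)
  (SigSub (sphere_point_subproof R d)).

End sphere_instances.

Definition borel_sphere (R : realType) (d : nat) :=
  g_sigma_algebraType (@open (sphere R d)).

Definition rV_cons (R : realType) (n : nat)
    (p : borel_rV R n * measurableTypeR R) : borel_rV R n.+1 :=
  \row_(i < n.+1) if unlift ord0 i is Some j then (p.1 : 'rV[R]_n) 0 j else p.2.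

Section rV_cons_theory.
Variables (R : realType) (n : nat).

Lemma rV_cons0 (p : borel_rV R n * measurableTypeR R) :
  (rV_cons p : 'rV[R]_n.+1) 0 0 = p.2.
Proof. by rewrite mxE unlift_none. Qed.

Lemma rV_consS (p : borel_rV R n * measurableTypeR R) (i : 'I_n) :
  (rV_cons p : 'rV[R]_n.+1) 0 (lift ord0 i) = (p.1 : 'rV[R]_n) 0 i.
Proof. by rewrite mxE liftK. Qed.

Lemma open_rV_box (m : nat) (a e : 'I_m -> R) :
  open [set v : 'rV[R]_m | forall i, `|a i - v 0 i| < e i].
Proof.
rewrite openE => v /= h.
apply: (@filter_forall _ _ (fun i => [set w : 'rV[R]_m | `|a i - w 0 i| < e i])
  (nbhs v) _ _) => i.
have hi : 0 < e i - `|a i - v 0 i| by rewrite subr_gt0.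
have /cvgrPdist_lt /(_ _ hi) := @coord_continuous R 1 m 0 i v.
apply: filterS => w /= vw; rewrite -(subrKA (v 0 i)).
by rewrite (le_lt_trans (ler_normD _ _))// -ltrBrDl.
Qed.

Lemma measurable_rV_cons : measurable_fun setT (@rV_cons R n).
Proof.
apply: (@measurability _ _ _ (borel_rV R n.+1) setT (@rV_cons R n)
  (@open 'rV[R]_n.+1) erefl) => _ [U oU <-].
pose box (q : 'rV[rat]_n.+1) (e : rat) : set 'rV[R]_n.+1 :=
  [set v | forall i, `|ratr (q 0 i) - v 0 i| < ratr e].
rewrite setTI.
have -> : @rV_cons R n @^-1` U = \bigcup_(qe : {qe : 'rV[rat]_n.+1 * rat |
    `[< box qe.1 qe.2 `<=` U >]}) @rV_cons R n @^-1` (box (sval qe).1 (sval qe).2).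
  rewrite -preimage_bigcup; congr (_ @^-1` _); apply/seteqP; split; last first.
    by move=> v [[qe /= /asboolP qeU] _ /=]; exact: qeU.
  move=> v Uv.
  have /nbhs_ballP[e /= e0 veU] : nbhs v U by exact: open_nbhs_nbhs.
  have e2 : e / 4 < e / 2 by lra.
  have [r /=] := rat_in_itvoo e2; rewrite in_itv /= => /andP[er re].
  have r0 : 0 < (ratr r : R) by apply: lt_trans er; lra.
  have /choice[q qv] : forall i : 'I_n.+1, exists q : rat,
      `|ratr q - v 0 i| < ratr r.
    move=> i; have : v 0 i - ratr r < v 0 i + ratr r by lra.
    move=> /rat_in_itvoo[q]; rewrite in_itv /= => qvi; exists q.
    by rewrite ltr_distl.
  have bU : box (\row_i q i) r `<=` U.
    move=> w bw; apply: veU; split => // i j; rewrite ord1 -ball_normE /=.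
    have := bw j; rewrite mxE => bj.
    rewrite -(subrKA (ratr (q j))) (le_lt_trans (ler_normD _ _))//.
    have := qv j; rewrite distrC => qj; lra.
  exists (exist _ (\row_i q i, r) (asboolT bU)) => //= i.
  by rewrite mxE.
apply: countable_bigcupT_measurable => // -[[q e] /= _].
have -> : @rV_cons R n @^-1` box q e =
  [set v : 'rV[R]_n | forall i, `|ratr (q 0 (lift ord0 i)) - v 0 i| < ratr e]
  `*` [set x : R | `|ratr (q 0 0) - x| < ratr e].
  apply/seteqP; split => -[v x] /=.
    move=> h; split=> [i|]; first by have := h (lift ord0 i); rewrite rV_consS.
    by have := h 0; rewrite rV_cons0.
  move=> [h0 h1] i; case: (unliftP ord0 i) => [j|] ->.
    by rewrite rV_consS.
  by rewrite rV_cons0.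
apply: measurableX.
  apply: sub_sigma_algebra.
  refine (@open_rV_box n (fun i => ratr (q 0 (lift ord0 i))) (fun=> ratr e)).
rewrite (_ : mkset _ = `](ratr (q 0 0) - ratr e), (ratr (q 0 0) + ratr e)[%classic).
  exact: measurable_itv.
by apply/seteqP; split => x /=; rewrite in_itv /= distrC ltr_distl.
Qed.

End rV_cons_theory.

Section lebesgue_rV.
Variable R : realType.
Local Open Scope ereal_scope.

Definition lebesgue_rV_step (n : nat) (m : {measure set (borel_rV R n) -> \bar R}) :
    set (borel_rV R n.+1) -> \bar R :=
  pushforward (m \x @lebesgue_measure R) (@rV_cons R n).

Section step.
Variables (n : nat) (m : {measure set (borel_rV R n) -> \bar R}).

Let step0 : lebesgue_rV_step m set0 = 0.
Proof. by rewrite /lebesgue_rV_step /pushforward preimage_set0 measure0. Qed.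

Let step_ge0 A : 0 <= lebesgue_rV_step m A.
Proof. by rewrite /lebesgue_rV_step /pushforward; exact: measure_ge0. Qed.

Let step_sigma_additive : semi_sigma_additive (lebesgue_rV_step m).
Proof.
move=> F mF tF mUF; rewrite /lebesgue_rV_step /pushforward preimage_bigcup.
apply: measure_semi_sigma_additive.
- by move=> k; rewrite -[X in measurable X]setTI; exact: measurable_rV_cons.
- apply/trivIsetP => /= i j _ _ ij; rewrite -preimage_setI.
  by move/trivIsetP : tF => /(_ _ _ _ _ ij) ->//; rewrite preimage_set0.
- rewrite -preimage_bigcup -[X in measurable X]setTI.
  exact: measurable_rV_cons.
Qed.

HB.instance Definition _ := isMeasure.Build _ _ _ (lebesgue_rV_step m)
  step0 step_ge0 step_sigma_additive.

End step.

(* Lebesgue measure on R^n, as the n-fold product of Lebesgue measure on R. *)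
Fixpoint lebesgue_rV (n : nat) : {measure set (borel_rV R n) -> \bar R} :=
  match n with
  | 0%N => \d_(0%R : borel_rV R 0)
  | k.+1 => lebesgue_rV_step (lebesgue_rV k)
  end.

Lemma measurable_rV_box (n : nat) (a b : R) :
  measurable ([set v | forall i, a <= (v : 'rV[R]_n) ord0 i <= b]%R : set (borel_rV R n)).
Proof.
rewrite (_ : mkset _ = \bigcap_(k in [set: nat])
  ([set v | forall i, `|(a + b) / 2 - (v : 'rV[R]_n) ord0 i| < (b - a) / 2 + k.+1%:R^-1]%R
    : set (borel_rV R n))).
  apply: bigcap_measurable; first by exists 0%N.
  move=> k _; apply: sub_sigma_algebra.
  refine (@open_rV_box _ n (fun=> (a + b) / 2)%R (fun=> (b - a) / 2 + k.+1%:R^-1)%R).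
apply/seteqP; split=> [v /= h k _ i|v /= h i].
  have k0 : (0 < k.+1%:R^-1 :> R)%R by rewrite invr_gt0.
  move: k0 (h i); generalize (k.+1%:R^-1 : R)%R (v ord0 i) => e x e0 /andP[ax xb].
  by rewrite ltr_norml; apply/andP; split; lra.
have : (`|(a + b) / 2 - (v : 'rV[R]_n) ord0 i| <= (b - a) / 2)%R.
  apply/ler_addgt0Pr => e e0.
  have [k ke] := ltr_add_invr e0.
  have := h k I i; move=> /ltW/le_trans; apply.
  by rewrite lerD2l; move: ke; rewrite add0r => /ltW.
generalize (v ord0 i) => x.
by rewrite ler_norml => /andP[? ?]; apply/andP; split; lra.
Qed.

Lemma lebesgue_rV_box (n : nat) (a b : R) : (a <= b)%R ->
  lebesgue_rV n [set v | forall i, a <= (v : 'rV[R]_n) ord0 i <= b]%R =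
  ((b - a) ^+ n)%:E.
Proof.
move=> ab; elim: n => [|n ih] /=.
  rewrite expr0 diracE (_ : _ \in _ = true)//.
  by apply/mem_set => -[].
rewrite /lebesgue_rV_step /pushforward.
rewrite (_ : _ @^-1` _ = ([set v | forall i, a <= (v : 'rV[R]_n) ord0 i <= b]%R :
    set (borel_rV R n)) `*` (`[a, b]%classic : set (measurableTypeR R))).
  rewrite product_measure1E//; last exact: measurable_rV_box.
  rewrite ih [X in _ * X](_ : _ = (b - a)%:E); first by rewrite -EFinM exprSr.
  apply: etrans (@lebesgue_measure_itv R `[a, b]) _.
  rewrite /= lte_fin; case: ltrP => [_|ba]; first by rewrite -EFinB.
  have -> : a = b by apply/eqP; rewrite eq_le ab.
  by rewrite subrr.
apply/seteqP; split => -[v x] /=.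
  move=> h; split=> [i|]; first by have := h (lift ord0 i); rewrite rV_consS.
  by have := h ord0; rewrite rV_cons0 in_itv.
move=> [h0 h1] i; case: (unliftP ord0 i) => [j|] ->.
  by rewrite rV_consS.
by rewrite rV_cons0; move: h1; rewrite in_itv.
Qed.

End lebesgue_rV.

Definition sphere_val (R : realType) (d : nat) (x : sphere R d) : 'rV[R]_d.+1 :=
  \val x.

Definition cone (R : realType) (d : nat) (A : set (sphere R d)) : set 'rV[R]_d.+1 :=
  [set v | exists x r, [/\ A x, 0 < r <= 1 & v = r *: sphere_val x]].

Section cone_theory.
Variables (R : realType) (d : nat).

Lemma dotrvZ (r : R) (v : 'rV[R]_d.+1) :
  dotrv (r *: v) (r *: v) = r ^+ 2 * dotrv v v.
Proof.
by rewrite /dotrv mulr_sumr; apply: eq_bigr => i _; rewrite !mxE; ring.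
Qed.

Lemma dotrv_sphere (x : sphere R d) : dotrv (sphere_val x) (sphere_val x) = 1.
Proof. by have /set_mem := valP x. Qed.

Lemma continuous_dotrv : continuous (fun v : 'rV[R]_d.+1 => dotrv v v).
Proof.
apply: continuous_big; first exact: add_continuous.
move=> i _ v; apply: cvgM; first exact: (nbhs_filter v).
  exact: coord_continuous.
exact: coord_continuous.
Qed.

Let f (v : 'rV[R]_d.+1) := (Num.sqrt (dotrv v v))^-1 *: v.

Let pr (v : borel_rV R d.+1) : borel_sphere R d := insubd (point : sphere R d) (f v).

Let B : set (borel_rV R d.+1) := [set v | 0 < dotrv v v <= 1].

Let sphere_val_pr v : 0 < dotrv v v -> sphere_val (pr v) = f v.
Proof.
move=> v0; rewrite /sphere_val /pr val_insubd ifT//.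
apply/mem_set; rewrite /sphere_set /= dotrvZ exprVn sqr_sqrtr ?ltW//.
by rewrite mulVf// gt_eqF.
Qed.

Let coneE (A : set (borel_sphere R d)) : cone A = B `&` pr @^-1` A.
Proof.
apply/seteqP; split => [v [x [r [Ax /andP[r0 r1] vE]]]|v [/andP[v0 v1] Av]].
  have vv : dotrv v v = r ^+ 2 by rewrite vE dotrvZ dotrv_sphere mulr1.
  have v0 : 0 < dotrv v v by rewrite vv exprn_gt0.
  have prv : pr v = x.
    apply: val_inj; rewrite -[LHS]/(sphere_val (pr v)) sphere_val_pr// /f vv.
    by rewrite sqrtr_sqr gtr0_norm// vE scalerA mulVf ?gt_eqF// scale1r.
  by split; rewrite /B /= ?prv// v0 vv expr_le1// ltW.
exists (pr v), (Num.sqrt (dotrv v v)); split=> //.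
  by rewrite sqrtr_gt0 v0 /= -sqrtr1 ler_sqrt.
by rewrite sphere_val_pr// scalerA divff ?scale1r// gt_eqF// sqrtr_gt0.
Qed.

Lemma cone_setT (v : 'rV[R]_d.+1) : 0 < dotrv v v <= 1 -> cone setT v.
Proof. by rewrite coneE. Qed.

Let open_pos : open [set v : 'rV[R]_d.+1 | 0 < dotrv v v].
Proof.
have /continuousP/(_ _ (@open_gt R 0)) := continuous_dotrv; exact.
Qed.

Let mB : measurable B.
Proof.
rewrite (_ : B = [set v | 0 < dotrv v v] `&` ~` [set v | 1 < dotrv v v]).
  apply: measurableI; first exact: sub_sigma_algebra.
  apply: measurableC; apply: sub_sigma_algebra.
  have /continuousP/(_ _ (@open_gt R 1)) := continuous_dotrv; exact.
apply/seteqP; split=> [v /andP[v0 v1]|v [v0 /negP v1]].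
  by split=> //; apply/negP; rewrite -leNgt.
by apply/andP; split=> //; rewrite leNgt.
Qed.

Let mpr : measurable_fun B pr.
Proof.
apply: (@measurability _ _ _ (borel_sphere R d) B pr (@open (sphere R d)) erefl).
move=> _ [U [W oW <-] <-].
have -> : B `&` pr @^-1` (set_val @^-1` W) =
    B `&` ([set v | 0 < dotrv v v] `&` f @^-1` W).
  apply/seteqP; split=> v [Bv] /=; have /andP[v0 _] := Bv.
    by move=> Wv; split=> //; split=> //; rewrite /= -sphere_val_pr.
  by move=> [_ Wv]; split=> //; move: Wv; rewrite -sphere_val_pr.
apply: measurableI => //; apply: sub_sigma_algebra.
rewrite openE => v [/= v0 Wv].
apply: filterI; first by apply: open_nbhs_nbhs.
have : {for v, continuous f}.
  refine (@cvgZ R 'rV[R]_d.+1 _ (nbhs v) (nbhs_filter v)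
    (fun v => (Num.sqrt (dotrv v v))^-1) id _ _ _ cvg_id).
  apply: (@cvgV R _ (nbhs v) (nbhs_filter v)).
    by rewrite gt_eqF// sqrtr_gt0.
  apply: (@continuous_cvg _ _ _ (nbhs v) (nbhs_filter v)
    (fun v : 'rV[R]_d.+1 => dotrv v v)).
    exact: sqrt_continuous.
  exact: continuous_dotrv.
by apply; apply: open_nbhs_nbhs.
Qed.

Lemma measurable_cone (A : set (borel_sphere R d)) :
  measurable A -> measurable (cone A : set (borel_rV R d.+1)).
Proof. by move=> mA; rewrite coneE; exact: mpr. Qed.

Lemma cone0 : cone (set0 : set (sphere R d)) = set0.
Proof. by rewrite coneE preimage_set0 setI0. Qed.

Lemma cone_bigcup (F : (set (sphere R d))^nat) :
  cone (\bigcup_k F k) = \bigcup_k cone (F k).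
Proof.
rewrite coneE preimage_bigcup setI_bigcupr.
by apply: eq_bigcupr => k _; rewrite coneE.
Qed.

Lemma trivIset_cone (F : (set (sphere R d))^nat) :
  trivIset setT F -> trivIset setT (fun k => cone (F k)).
Proof.
move=> /trivIsetP tF; apply/trivIsetP => i j _ _ ij.
rewrite !coneE setIACA; apply/seteqP; split => // v [_ [/= Fi Fj]].
have : (F i `&` F j) (pr v) by [].
by rewrite tF.
Qed.

End cone_theory.

Section surface_measure.
Variables (R : realType) (d : nat).
Local Open Scope ereal_scope.

(* Surface area through polar coordinates: since Lebesgue measure in R^(d+1) is
   r^d dr times surface measure, the cone over A of radius 1 has volume
   area(A) / (d + 1). *)
Definition surface_measure (A : set (borel_sphere R d)) : \bar R :=
  d.+1%:R%:E * lebesgue_rV R d.+1 (cone A).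

Let surface_measure0 : surface_measure set0 = 0.
Proof. by rewrite /surface_measure cone0 measure0 mule0. Qed.

Let surface_measure_ge0 A : 0 <= surface_measure A.
Proof. by rewrite /surface_measure mule_ge0// lee_fin. Qed.

Let surface_measure_sigma_additive : semi_sigma_additive surface_measure.
Proof.
move=> F mF tF mUF; rewrite /surface_measure.
under eq_fun do rewrite -ge0_sume_distrr//.
apply: cvgeZl => //; rewrite cone_bigcup.
apply: measure_semi_sigma_additive; last 1 first.
- by rewrite -cone_bigcup; exact: measurable_cone.
- by move=> k; exact: measurable_cone.
- exact: trivIset_cone.
Qed.

HB.instance Definition _ := isMeasure.Build _ _ _ surface_measure
  surface_measure0 surface_measure_ge0 surface_measure_sigma_additive.

Lemma surface_measure_setT : 0 < surface_measure setT < +oo.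
Proof.
have d0 : (0 < d.+1%:R :> R)%R by [].
apply/andP; split.
  apply: mule_gt0; first by rewrite lte_fin.
  pose a : R := d.+1%:R^-1%R.
  have a0 : (0 < a)%R by rewrite invr_gt0.
  apply: (@lt_le_trans _ _ (lebesgue_rV R d.+1
      [set v | forall i, a / 2 <= (v : 'rV[R]_d.+1) ord0 i <= a]%R)).
    rewrite lebesgue_rV_box; last by lra.
    by rewrite lte_fin exprn_gt0//; lra.
  apply: le_measure; rewrite ?inE.
  - exact: measurable_rV_box.
  - exact: measurable_cone.
  move=> v /= hv.
  apply: cone_setT; apply/andP; split.
    rewrite /dotrv (bigD1 ord0)//= ltr_pwDl//.
      by have /andP[? _] := hv ord0; apply: mulr_gt0; lra.
    by apply: sumr_ge0 => i _; exact: sqr_ge0.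
  apply: (@le_trans _ _ (\sum_(i < d.+1) a)%R).
    apply: ler_sum => i _; have /andP[? ?] := hv i.
    have a1 : (a <= 1)%R by rewrite /a invf_le1// ler1n.
    by nra.
  by rewrite sumr_const card_ord -[(a *+ _)%R]mulr_natl divff.
apply: lte_mul_pinfty; [by rewrite lee_fin| by [] |].
apply: (@le_lt_trans _ _ (lebesgue_rV R d.+1
    [set v | forall i, -1 <= (v : 'rV[R]_d.+1) ord0 i <= 1]%R)).
  apply: le_measure; rewrite ?inE.
  - exact: measurable_cone.
  - exact: measurable_rV_box.
  move=> v [x [r [_ /andP[r0 r1] ->]]] i.
  have : (sphere_val x 0 i ^+ 2 <= 1)%R.
    rewrite -(dotrv_sphere x) /dotrv (bigD1 i)//= expr2 lerDl.
    by apply: sumr_ge0 => j _; exact: sqr_ge0.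
  rewrite mxE -real_normK ?num_real// expr_le1// ler_norml => /andP[? ?].
  by apply/andP; split; nra.
by rewrite lebesgue_rV_box ?ltry//; lra.
Qed.

Definition sigma_sphere (A : set (borel_sphere R d)) : \bar R :=
  (fine (surface_measure setT))^-1%:E * surface_measure A.

Let c0 : (0 <= (fine (surface_measure setT))^-1)%R.
Proof. by rewrite invr_ge0 fine_ge0. Qed.

Let sigma_sphere0 : sigma_sphere set0 = 0.
Proof. by rewrite /sigma_sphere measure0 mule0. Qed.

Let sigma_sphere_ge0 A : 0 <= sigma_sphere A.
Proof. by rewrite /sigma_sphere mule_ge0. Qed.

Let sigma_sphere_sigma_additive : semi_sigma_additive sigma_sphere.
Proof.
move=> F mF tF mUF; rewrite /sigma_sphere.
under eq_fun do rewrite -ge0_sume_distrr//.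
by apply: cvgeZl => //; exact: measure_semi_sigma_additive.
Qed.

HB.instance Definition _ := isMeasure.Build _ _ _ sigma_sphere
  sigma_sphere0 sigma_sphere_ge0 sigma_sphere_sigma_additive.

Let sigma_sphere_setT : sigma_sphere setT = 1.
Proof.
have /andP[s0 soo] := surface_measure_setT.
rewrite /sigma_sphere -{2}(@fineK _ (surface_measure setT)) ?ge0_fin_numE ?ltW//.
by rewrite -EFinM mulVf// gt_eqF// fine_gt0// s0.
Qed.

HB.instance Definition _ := Measure_isProbability.Build _ _ _ sigma_sphere
  sigma_sphere_setT.

End surface_measure.

Section energy.
Variables (R : realType) (d : nat).
Local Open Scope ereal_scope.

(* [`^] sends base 0 to 0 for every nonzero exponent, so the value +oo at t = 1
   for delta <= 0 has to be given explicitly. *)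
Definition geodesic_kernel (delta t : R) : \bar R :=
  if ((delta <= 0) && (t == 1))%R then +oo
  else if delta == 0%R then (ln (pi / acos t))%:E
  else (acos t `^ delta)%:E.

Definition geodesic_energy (delta : R) (mu : probability (borel_sphere R d) R) : \bar R :=
  \int[mu]_y \int[mu]_x geodesic_kernel delta (dotrv (sphere_val x) (sphere_val y)).

(* Two measures are compared on measurable sets only: a value of type
   [probability T R] is a function on all sets, and its values on
   non-measurable sets are irrelevant. *)
Definition same_measure (mu nu : probability (borel_sphere R d) R) : Prop :=
  forall A, measurable A -> mu A = nu A.

Definition unique_maximizer (I : probability (borel_sphere R d) R -> \bar R)
    (nu : probability (borel_sphere R d) R) : Prop :=
  (forall mu, I mu <= I nu) /\
  (forall mu, (forall mu', I mu' <= I mu) -> same_measure mu nu).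

Definition unique_minimizer (I : probability (borel_sphere R d) R -> \bar R)
    (nu : probability (borel_sphere R d) R) : Prop :=
  (forall mu, I nu <= I mu) /\
  (forall mu, (forall mu', I mu <= I mu') -> same_measure mu nu).

End energy.

(* Main.v *)
From HB Require Import structures.
Require Import Defs.
From mathcomp Require Import all_boot all_order all_algebra.
From mathcomp Require Import all_classical all_reals all_analysis.
From mathcomp Require Import measurable_realfun ring lra.

(** The kernel is expanded in powers of the inner product x.y.

    Put u(t) = 1 - (2 / pi) acos t.  Its derivative (2 / pi) (1 - t^2)^(-1/2)
    has a power series with nonnegative coefficients and a positive constant
    term, so u has nonnegative coefficients and a positive linear one.  As
    acos t = (pi / 2) (1 - u), all coefficients of
    1 / acos t = (2 / pi) (1 + u + u^2 + ...) are positive.  Integrating and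
    exponentiating, the same holds for log (pi / acos t), for (acos t)^delta
    with delta < 0, and for pi^delta - (acos t)^delta with 0 < delta < 1
    ([strict_absmon_log], [strict_absmon_powN], [strict_absmon_powP]).

    For a probability measure mu, the energy of the kernel (x.y)^n is the sum of
    the squares of the moments of mu of degree n.  The integral of (x.y)^n
    against sigma in the variable x does not depend on y, because sigma is
    invariant under reflections; expanding squares, the energy of mu exceeds
    that of sigma by the sum of the squared differences of the moments
    ([moment_gap]).  Adding up the power series with its positive coefficients,
    sigma has the least energy, and the excess of the energy of mu bounds the
    excess of each degree ([admissible_energy_gap]).  The series need not
    converge at t = 1 and t = -1, so one works with F(r t) for r < 1 and lets r
    tend to 1 by dominated convergence.

    If mu has the same energy as sigma, and this energy is finite, then all
    moments agree, and moments determine a measure on the sphere because Borel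
    indicators arise from polynomials by bounded limits
    ([same_measure_of_moments]).  The energy of sigma is finite for delta > - d
    because a cap of radius rho has measure O(rho^d)
    ([geodesic_energy_sigma_lty]).

    The reflection invariance of sigma is that of Lebesgue measure, which follows
    from its translation invariance by the Tonelli theorem
    ([measure_orthogonal]). *)

Set Implicit Arguments.
Unset Strict Implicit.
Unset Printing Implicit Defensive.

Import Order.TTheory GRing.Theory Num.Theory.
Import numFieldNormedType.Exports.

Local Open Scope classical_set_scope.
Local Open Scope ring_scope.

(** * Integrals of bounded functions *)

Section bounded_integrals.
Context d (T : measurableType d) (R : realType).
Variables (mu : {measure set T -> \bar R}) (D : set T).
Hypotheses (mD : measurable D) (muD : (mu D < +oo)%E).
Implicit Types (f : T -> R) (C : R).

Lemma bounded_integrable f C : measurable_fun D f ->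
  (forall x, D x -> `|f x| <= C) -> mu.-integrable D (EFin \o f).
Proof.
move=> mf fC; apply: measurable_bounded_integrable => //.
exists C; split; first exact: num_real.
by move=> M /ltW CM x /= Dx; exact: le_trans (fC _ Dx) CM.
Qed.

Lemma bounded_cvg_Rintegral (f_ : nat -> T -> R) f C :
  (forall k, measurable_fun D (f_ k)) ->
  (forall k x, D x -> `|f_ k x| <= C) ->
  (forall x, D x -> f_ k x @[k --> \oo] --> f x) ->
  \int[mu]_(x in D) f_ k x @[k --> \oo] --> \int[mu]_(x in D) f x.
Proof.
move=> mf f_C f_f; have mfl := measurable_fun_cvg mf f_f.
have [] := @dominated_convergence _ T R mu D mD (fun k => EFin \o f_ k)
  (EFin \o f) (EFin \o cst C) _ _ _ _ _.
- by move=> k; exact/measurable_EFinP.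
- exact/measurable_EFinP.
- by apply: aeW => x Dx; apply: cvg_EFin; [exact: nearW|exact: f_f].
- by apply: (@bounded_integrable (cst C) `|C|) => // x _ /=.
- by apply: aeW => x k Dx; rewrite lee_fin; exact: f_C.
move=> fi _ h; apply: fine_cvg.
rewrite /Rintegral fineK; last exact: integrable_fin_num.
exact: h.
Qed.

End bounded_integrals.

(** * Power series with nonnegative coefficients *)

Section absolutely_monotone.
Variable R : realType.
Implicit Types (f g : R -> R) (t c : R).

(** The functions with a power series on (-1, 1) whose coefficients are
    nonnegative.  They are generated from monomials by sums and pointwise
    limits, so that each closure property below is an induction and no series
    has to be rearranged. *)
Inductive absmon : (R -> R) -> Prop :=
| absmon_monom c n : 0 <= c -> absmon (fun t => c * t ^+ n)
| absmonD f g : absmon f -> absmon g -> absmon (fun t => f t + g t)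
| absmon_lim (f_ : nat -> R -> R) f : (forall k, absmon (f_ k)) ->
    (forall t, `|t| < 1 -> f_ k t @[k --> \oo] --> f t) -> absmon f.

Lemma eq_absmon f g : (forall t, `|t| < 1 -> f t = g t) -> absmon f -> absmon g.
Proof.
move=> fg af; apply: (@absmon_lim (fun=> f)) => // t t1.
by rewrite fg//; exact: cvg_cst.
Qed.

Lemma absmon_cst c : 0 <= c -> absmon (fun=> c).
Proof.
by move=> c0; apply: eq_absmon (absmon_monom 0 c0) => t _; rewrite mulr1.
Qed.

Lemma absmon_id : absmon id.
Proof.
by apply: eq_absmon (absmon_monom 1 (@ler01 R)) => t _; rewrite mul1r expr1.
Qed.

Lemma absmonM f g : absmon f -> absmon g -> absmon (fun t => f t * g t).
Proof.
move=> af ag; elim: af => {f} [c n c0|f1 f2 _ a1 _ a2|f_ f _ a_ f_f].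
- elim: ag => {g} [d m d0|g1 g2 _ a1 _ a2|g_ g _ a_ g_g].
  + have := absmon_monom (n + m) (mulr_ge0 c0 d0).
    by apply: eq_absmon => t _; rewrite exprD mulrACA.
  + by apply: eq_absmon (absmonD a1 a2) => t _; rewrite mulrDr.
  + apply: (absmon_lim a_) => t t1; apply: cvgM; first exact: cvg_cst.
    exact: g_g.
- by apply: eq_absmon (absmonD a1 a2) => t _; rewrite mulrDl.
- apply: (absmon_lim a_) => t t1; apply: cvgM; last exact: cvg_cst.
  exact: f_f.
Qed.

Lemma absmonZ c f : 0 <= c -> absmon f -> absmon (fun t => c * f t).
Proof. by move=> c0; apply: absmonM; exact: absmon_cst. Qed.

Lemma absmonX f n : absmon f -> absmon (fun t => f t ^+ n).
Proof.
move=> af; elim: n => [|n ih]; first exact: absmon_cst.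
by apply: eq_absmon (absmonM af ih) => t _; rewrite exprS.
Qed.

Lemma absmon_sum (n : nat) (F : nat -> R -> R) :
  (forall i, absmon (F i)) -> absmon (fun t => \sum_(i < n) F i t).
Proof.
move=> aF; elim: n => [|n ih].
  by apply: eq_absmon (absmon_cst (lexx 0)) => t _; rewrite big_ord0.
by apply: eq_absmon (absmonD ih (aF n)) => t _; rewrite big_ord_recr.
Qed.

Lemma absmon_comp f g : absmon f -> absmon g ->
  (forall t, `|t| < 1 -> `|g t| < 1) -> absmon (fun t => f (g t)).
Proof.
move=> af ag g1; elim: af => {f} [c n c0|f1 f2 _ a1 _ a2|f_ f _ a_ f_f].
- exact/absmonZ/absmonX.
- exact: absmonD.
- by apply: (absmon_lim a_) => t /g1; exact: f_f.
Qed.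

(** Clear for monomials and preserved by sums and limits.  This is the source
    of all the domination needed below: a sequence in the class that converges
    at s is bounded uniformly on [-s, s]. *)
Lemma absmon_norm_le f t (s : R) : absmon f -> `|t| <= s -> s < 1 -> `|f t| <= f s.
Proof.
move=> + ts s1; have s0 : 0 <= s := le_trans (normr_ge0 t) ts.
elim=> {f} [c n c0|f1 f2 _ a1 _ a2|f_ f _ a_ f_f].
- by rewrite normrM normrX (ger0_norm c0) ler_wpM2l// lerXn2r// nnegrE.
- by rewrite (le_trans (ler_normD _ _))// lerD.
- have t1 : `|t| < 1 by exact: le_lt_trans s1.
  have s1' : `|s| < 1 by rewrite ger0_norm.
  have fs := f_f _ s1'.
  have ft : `|f_ k t| @[k --> \oo] --> `|f t| by apply: cvg_norm; exact: f_f.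
  rewrite -(cvg_lim _ ft)// -(cvg_lim _ fs)//.
  by apply: ler_lim; [exact: cvgP ft|exact: cvgP fs|exact: nearW].
Qed.

(** The exponential series without its first two terms.  Keeping f apart is what
    transfers the positivity of a coefficient of f to [expR \o f]. *)
Lemma absmon_expRB1 f : absmon f -> absmon (fun t => expR (f t) - 1 - f t).
Proof.
move=> af.
apply: (@absmon_lim (fun n t => \sum_(k < n) (k.+2`!%:R)^-1 * f t ^+ k.+2)).
  move=> n; apply: (@absmon_sum n (fun k t => (k.+2`!%:R)^-1 * f t ^+ k.+2)) => k.
  by apply: absmonZ; [rewrite invr_ge0|exact: absmonX].
move=> t _; have /cvgP := @is_cvg_series_exp_coeff R (f t).
rewrite -/(expR (f t)) => h.
have {}h : series (exp_coeff (f t)) (n + 2)%N - 1 - f t @[n --> \oo] -->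
    expR (f t) - 1 - f t.
  apply: cvgB; last exact: cvg_cst.
  apply: cvgB; last exact: cvg_cst.
  by move: h; rewrite -(cvg_shiftn 2).
apply: cvg_trans h; apply: near_eq_cvg; near=> n.
rewrite addn2 /series/= big_mkord !big_ord_recl/= /exp_coeff/= !expr0 !fact0 !divr1 expr1.
rewrite (eq_bigr (fun k : 'I_n => (k.+2`!%:R)^-1 * f t ^+ k.+2)); first by ring.
by move=> k _; rewrite mulrC.
Unshelve. all: by end_near. Qed.

End absolutely_monotone.

(** * Primitives of power series *)

Section primitive.
Variable R : realType.
Implicit Types (f g F : R -> R) (s t c : R).
Local Notation mu := (@lebesgue_measure R).
Local Notation I01 := (`[0, 1]%classic : set R).

(** The primitive of g that vanishes at 0, written over the fixed segment
    [0, 1] so that s may have either sign. *)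
Definition unit_segment_primitive g s : R :=
  \int[mu]_(x in `[0, 1]) (s * g (s * x)).

Local Notation prim := unit_segment_primitive.

Let norm_segment s (x : R) : x \in `[0, 1] -> `|s * x| <= `|s|.
Proof.
rewrite in_itv/= => /andP[x0 x1].
by rewrite normrM ler_piMr// ger0_norm.
Qed.

Lemma unit_segment_FTC F g s : `|s| < 1 ->
  (forall t, `|t| < 1 -> is_derive t 1 F (g t)) ->
  (forall t, `|t| < 1 -> {for t, continuous g}) ->
  prim g s = F s - F 0.
Proof.
move=> s1 dF cg.
have sx1 (x : R) : x \in `[0, 1] -> `|s * x| < 1.
  by move=> x01; apply: le_lt_trans s1; exact: norm_segment.
have dFs (x : R) : x \in `[0, 1] -> is_derive x 1 (fun x => F (s * x)) (s * g (s * x)).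
  move=> x01; rewrite mulrC.
  have Dsx : is_derive x 1 (fun x => s * x) s.
    by apply: is_derive_eq; rewrite scaler1.
  exact: (@is_derive1_comp _ F (fun x => s * x) x _ _ (dF _ (sx1 _ x01)) Dsx).
have cFs (x : R) : x \in `[0, 1] -> {for x, continuous (fun x => F (s * x))}.
  move=> x01; apply/differentiable_continuous/derivable1_diffP.
  by have [] := dFs _ x01.
rewrite /prim /Rintegral.
rewrite (@continuous_FTC2 _ _ (fun x => F (s * x)))//=.
- by rewrite mulr1 mulr0.
- apply: continuous_in_subspaceT => x /[!inE] x01.
  apply: continuousM; first exact: cvg_cst.
  apply: (@continuous_comp _ _ _ (fun x => s * x) g); last exact/cg/sx1.
  by apply: continuousM; [exact: cvg_cst|exact: cvg_id].
- split.
  + move=> x x01; have [] := dFs x; last by [].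
    exact: subset_itv_oo_cc x01.
  + by apply: cvg_at_right_filter; apply: cFs; rewrite in_itv/= lexx ler01.
  + by apply: cvg_at_left_filter; apply: cFs; rewrite in_itv/= lexx ler01.
- move=> x x01; rewrite derive1E; apply: derive_val.
  by apply: dFs; exact: subset_itv_oo_cc x01.
Qed.

Lemma measurable_absmon_segment f s : absmon f -> `|s| < 1 ->
  measurable_fun I01 (fun x : R => f (s * x)).
Proof.
move=> + s1; elim=> {f} [c n c0|f1 f2 _ a1 _ a2|f_ f af_ a_ f_f].
- apply: measurable_funTS; apply: measurable_funM => //.
  by apply: measurable_funX; exact: measurable_funM.
- exact: measurable_funD.
- apply: (@measurable_fun_cvg _ _ _ _ (fun k x => f_ k (s * x))) => // x x01.
  by apply: f_f; apply: le_lt_trans s1; exact: norm_segment.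
Qed.

Let segment_lty : (mu I01 < +oo)%E.
Proof. by rewrite lebesgue_measure_itv/= lte01 -EFinB ltry. Qed.

Let integrable_segment f s : absmon f -> `|s| < 1 ->
  mu.-integrable I01 (EFin \o (fun x => s * f (s * x))).
Proof.
move=> af s1; apply: (@bounded_integrable _ _ _ _ _ _ _ _ (f `|s|)) => //.
  by apply: measurable_funM => //; exact: measurable_absmon_segment.
move=> x x01; rewrite normrM; have := norm_segment s x01.
move/(absmon_norm_le af)=> /(_ s1); have := normr_ge0 (f (s * x)).
by have := normr_ge0 s; nra.
Qed.

(** Monomials are integrated by the fundamental theorem of calculus; limits
    commute with the integral by dominated convergence, since the convergent
    sequence of the values at [`|s|] bounds the integrands. *)
Lemma absmon_prim g : absmon g -> absmon (prim g).
Proof.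
elim=> {g} [c n c0|f1 f2 af1 a1 af2 a2|f_ f af_ a_ f_f].
- have cn0 : 0 <= c / n.+1%:R by rewrite divr_ge0.
  apply: eq_absmon (absmon_monom n.+1 cn0) => s s1.
  have dF t : `|t| < 1 ->
      is_derive t 1 (fun t => c / n.+1%:R * t ^+ n.+1) (c * t ^+ n).
    move=> _.
    have dX : is_derive t 1 (@GRing.exp R ^~ n.+1) (n.+1%:R * t ^+ n).
      by apply: DeriveDef; [exact: exprn_derivable|rewrite exp_derive [LHS]mulr1].
    apply: is_derive_eq (is_deriveZ (c / n.+1%:R) dX) _.
    by rewrite /GRing.scale/= mulrA divfK// pnatr_eq0.
  have cg t : `|t| < 1 -> {for t, continuous (fun t => c * t ^+ n)}.
    move=> _; apply: continuousM; first exact: cvg_cst.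
    exact: exprn_continuous.
  by have -> := unit_segment_FTC s1 dF cg; rewrite expr0n mulr0 subr0.
- apply: eq_absmon (absmonD a1 a2) => s s1; rewrite /prim.
  under [RHS]eq_Rintegral do rewrite mulrDr.
  by rewrite RintegralD//; exact: integrable_segment.
- apply: (absmon_lim a_) => s s1.
  have s1' : `| `|s| | < 1 by rewrite normr_id.
  have [M [_ fM]] := cvg_seq_bounded (cvgP _ (f_f _ s1')).
  have M1 : M < M + 1 by rewrite ltrDl.
  apply: (@bounded_cvg_Rintegral _ _ _ _ _ _ _ _ _ (M + 1)) => //.
  + move=> k; apply: measurable_funM => //.
    exact: measurable_absmon_segment.
  + move=> k x x01; have := norm_segment s x01.
    move/(absmon_norm_le (af_ k)) => /(_ s1).
    have := fM (M + 1) M1 k I; rewrite /=.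
    rewrite normrM.
    have := ler_norm (f_ k `|s|).
    have := normr_ge0 (f_ k (s * x)).
    by have := normr_ge0 s; nra.
  + move=> x x01; apply: cvgM; first exact: cvg_cst.
    by apply: f_f; apply: le_lt_trans s1; exact: norm_segment.
Qed.

(** Nonnegativity of the Taylor coefficients of f is read off its derivative,
    up to the constant term. *)
Lemma absmon_derive f g : absmon g -> 0 <= f 0 ->
  (forall t, `|t| < 1 -> is_derive t 1 f (g t)) ->
  (forall t, `|t| < 1 -> {for t, continuous g}) ->
  absmon f.
Proof.
move=> ag f0 df cg; apply: eq_absmon (absmonD (absmon_prim ag) (absmon_cst f0)).
by move=> t t1; rewrite (unit_segment_FTC t1 df cg) subrK.
Qed.

End primitive.

(** * Power series with positive coefficients *)

Section strictly_absolutely_monotone.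
Variable R : realType.
Implicit Types (f g u : R -> R) (s t c : R) (n : nat).

(** All Taylor coefficients are positive: a small multiple of a monomial of any
    degree can be split off inside the class. *)
Definition strict_absmon f := forall n,
  exists2 c, 0 < c & absmon (fun t => f t - c * t ^+ n).

Lemma strict_absmonW f : strict_absmon f -> absmon f.
Proof.
move=> /(_ 0%N)[c c0 fc]; apply: eq_absmon (absmonD fc (absmon_cst (ltW c0))).
by move=> t _; rewrite expr0 mulr1 subrK.
Qed.

Lemma eq_strict_absmon f g : (forall t, `|t| < 1 -> f t = g t) ->
  strict_absmon f -> strict_absmon g.
Proof.
move=> fg sf n; have [c c0 fc] := sf n; exists c => //.
by apply: eq_absmon fc => t /fg ->.
Qed.

Lemma strict_absmonD f g : strict_absmon f -> absmon g ->
  strict_absmon (fun t => f t + g t).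
Proof.
move=> sf ag n; have [c c0 fc] := sf n; exists c => //.
by apply: eq_absmon (absmonD fc ag) => t _; rewrite addrAC.
Qed.

Lemma strict_absmonZ c f : 0 < c -> strict_absmon f ->
  strict_absmon (fun t => c * f t).
Proof.
move=> c0 sf n; have [e e0 fe] := sf n; exists (c * e); first exact: mulr_gt0.
by apply: eq_absmon (absmonZ (ltW c0) fe) => t _; rewrite mulrBr mulrA.
Qed.

(** f g = f + f (g - 1), where the second summand has nonnegative
    coefficients. *)
Lemma strict_absmonM f g : strict_absmon f -> absmon (fun t => g t - 1) ->
  strict_absmon (fun t => f t * g t).
Proof.
move=> sf ag; apply: eq_strict_absmon (strict_absmonD sf (absmonM (strict_absmonW sf) ag)).
by move=> t _; rewrite mulrBr mulr1 addrC subrK.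
Qed.

Lemma strict_absmon_expR f : strict_absmon f ->
  strict_absmon (fun t => expR (f t)).
Proof.
move=> sf; have af := strict_absmonW sf.
have := strict_absmonD sf (absmonD (absmon_expRB1 af) (absmon_cst (@ler01 R))).
by apply: eq_strict_absmon => t _; ring.
Qed.

(** Telescoping: u^(n+1) - (b t)^(n+1) = u^n (u - b t) + b t (u^n - (b t)^n). *)
Lemma absmonXB u (b : R) n : 0 <= b -> absmon u -> absmon (fun t => u t - b * t) ->
  absmon (fun t => u t ^+ n - (b * t) ^+ n).
Proof.
move=> b0 au ub; elim: n => [|n ih].
  by apply: eq_absmon (absmon_cst (lexx 0)) => t _; rewrite subrr.
have abt := absmonZ b0 (absmon_id R).
apply: eq_absmon (absmonD (absmonM (absmonX n au) ub) (absmonM abt ih)).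
by move=> t _; rewrite !exprS; ring.
Qed.

(** If the coefficient of degree n of f is at least c, that of [f \o u] is at
    least c b^n, because u^n dominates (b t)^n coefficientwise. *)
Lemma strict_absmon_comp f u (b : R) : strict_absmon f -> absmon u ->
  (forall t, `|t| < 1 -> `|u t| < 1) -> 0 < b -> absmon (fun t => u t - b * t) ->
  strict_absmon (fun t => f (u t)).
Proof.
move=> sf au u1 b0 ub n; have [c c0 fc] := sf n.
exists (c * b ^+ n); first by rewrite mulr_gt0// exprn_gt0.
have fcu := absmon_comp fc au u1.
have := absmonD fcu (absmonZ (ltW c0) (absmonXB n (ltW b0) au ub)).
by apply: eq_absmon => t _; rewrite exprMn; ring.
Qed.

Lemma strict_absmon_derive f g : strict_absmon g -> 0 < f 0 ->
  (forall t, `|t| < 1 -> is_derive t 1 f (g t)) ->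
  (forall t, `|t| < 1 -> {for t, continuous g}) ->
  strict_absmon f.
Proof.
move=> sg f0 df cg n; have [c c0 gc] := sg n.-1.
have [e e0 [ge fe]] : exists2 e, 0 < e &
    absmon (fun t => g t - e * (n%:R * t ^+ n.-1)) /\ 0 <= f 0 - e * 0 ^+ n.
  case: n gc => [|n] /= gc.
    exists (f 0) => //; split; last by rewrite expr0 mulr1 subrr.
    by apply: eq_absmon (strict_absmonW sg) => t _; rewrite mul0r mulr0 subr0.
  exists (c / n.+1%:R); first by rewrite divr_gt0.
  split; last by rewrite expr0n mulr0 subr0 ltW.
  by apply: eq_absmon gc => t _; rewrite mulrA divfK// pnatr_eq0.
exists e => //.
have dX t : is_derive t 1 (@GRing.exp R ^~ n) (n%:R * t ^+ n.-1).
  by apply: DeriveDef; [exact: exprn_derivable|rewrite exp_derive [LHS]mulr1].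
have dE t : `|t| < 1 ->
    is_derive t 1 (fun t => f t - e * t ^+ n) (g t - e * (n%:R * t ^+ n.-1)).
  by move=> /df fg; apply: is_deriveB.
apply: (absmon_derive ge fe dE) => t t1.
apply: continuousB; first exact: cg.
apply: continuousM; first exact: cvg_cst.
apply: continuousM; first exact: cvg_cst.
exact: exprn_continuous.
Qed.

Lemma strict_absmon_geometric : strict_absmon (fun t => (1 - t)^-1).
Proof.
have geo : absmon (fun t => (1 - t)^-1).
  apply: (@absmon_lim _ (fun n t => \sum_(k < n) t ^+ k)).
    move=> n; apply: (@absmon_sum _ n (fun k t => t ^+ k)) => k.
    by apply: absmonX; exact: absmon_id.
  move=> t /(@cvg_geometric_series R 1 t); rewrite mul1r; apply: cvg_trans.
  apply: near_eq_cvg; near=> n; rewrite /series/= big_mkord.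
  by apply: eq_bigr => k _; rewrite /geometric/= mul1r.
move=> n; exists 1 => //.
have aX k : absmon (fun t => t ^+ k) by apply: absmonX; exact: absmon_id.
have := absmonD (absmon_sum n aX) (absmonM (aX n.+1) geo).
apply: eq_absmon => t t1.
have t1' : 1 - t != 0 by rewrite subr_eq0 eq_sym lt_eqF// ltr_normlW.
have -> : \sum_(i < n) t ^+ i = (1 - t ^+ n) / (1 - t).
  apply: (mulIf t1'); rewrite divfK// mulrC.
  have := subrXX 1 t n; rewrite expr1n => ->; congr (_ * _).
  by apply: eq_bigr => i _; rewrite expr1n mul1r.
by rewrite exprS; field.
Unshelve. all: by end_near. Qed.

(** With v = t^2, the function is exp(- ln (1 - v) / 2) - 1, and - ln (1 - v)
    is the primitive of the geometric series. *)
Lemma absmon_inv_sqrt : absmon (fun t => (Num.sqrt (1 - t ^+ 2))^-1 - 1).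
Proof.
have h2 : 0 <= 2^-1 :> R by lra.
have aL : absmon (fun t => - ln (1 - t)).
  apply: (absmon_derive (strict_absmonW strict_absmon_geometric)).
  - by rewrite subr0 ln1 oppr0.
  - move=> t t1; have t0 : 0 < 1 - t by rewrite subr_gt0 ltr_normlW.
    have dB : is_derive t 1 (fun t : R => 1 - t) (0 - 1) by exact: is_deriveB.
    have := @is_derive1_comp _ (@ln R) (fun t => 1 - t) t _ _ (is_derive1_ln t0) dB.
    by move/is_deriveN => h; apply: is_derive_eq h _; rewrite sub0r mulrN1 opprK.
  - move=> t t1; have t0 : 0 < 1 - t by rewrite subr_gt0 ltr_normlW.
    apply: continuousV; first by rewrite gt_eqF.
    by apply: continuousB; [exact: cvg_cst|exact: cvg_id].
have aE : absmon (fun t => expR (2^-1 * - ln (1 - t)) - 1).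
  have aL2 := absmonZ h2 aL.
  by apply: eq_absmon (absmonD (absmon_expRB1 aL2) aL2) => t _; rewrite subrK.
have sq1 t : `|t| < 1 -> `|t ^+ 2| < 1 by move=> t1; rewrite normrX expr_lt1.
apply: eq_absmon (absmon_comp aE (absmonX 2 (absmon_id R)) sq1) => t t1 /=.
have t0 : 0 < 1 - t ^+ 2 by rewrite subr_gt0 (le_lt_trans (ler_norm _))// sq1.
congr (_ - 1); rewrite mulrN expRN; congr (_^-1).
by rewrite -powR12_sqrt ?ltW// /powR gt_eqF.
Qed.

Lemma norm_lt1_bounds t : `|t| < 1 -> -1 < t < 1. Proof. by rewrite ltr_norml. Qed.

Lemma acos_itv t : `|t| < 1 -> 0 < acos t < pi.
Proof.
move=> /norm_lt1_bounds/andP[t0 t1].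
by rewrite acos_gt0 ?acos_ltpi// ?t1 ?t0 ?ltW.
Qed.

Lemma continuous_inv_sqrt t : `|t| < 1 ->
  {for t, continuous (fun t => (Num.sqrt (1 - t ^+ 2))^-1)}.
Proof.
move=> t1; have t0 : 0 < 1 - t ^+ 2.
  by rewrite subr_gt0 (le_lt_trans (ler_norm _))// normrX expr_lt1.
apply: continuousV; first by rewrite gt_eqF// sqrtr_gt0.
apply: (@continuous_comp _ _ _ (fun t => 1 - t ^+ 2)); last exact: sqrt_continuous.
apply: continuousB; first exact: cvg_cst.
exact: exprn_continuous.
Qed.

(** The angle measured from the equator, scaled so that the poles are at 1 and
    -1; this is (2 / pi) asin t. *)
Definition normalized_colat t : R := 1 - 2 / pi * acos t.

Let pi_neq0 : pi != 0 :> R. Proof. by rewrite gt_eqF ?pi_gt0. Qed.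

(** The derivative is (2 / pi) ((1 - t^2)^(-1/2) - 1). *)
Lemma normalized_colat_absmonB :
  absmon (fun t => normalized_colat t - 2 / pi * t).
Proof.
have p2 : 0 <= 2 / pi :> R by rewrite divr_ge0// pi_ge0.
apply: (absmon_derive (absmonZ p2 absmon_inv_sqrt)).
- have -> : normalized_colat 0 - 2 / pi * 0 = 0.
    rewrite /normalized_colat acos0; move: pi_neq0; move: (pi : R) => p p0.
    by field.
  exact: lexx.
- move=> t /norm_lt1_bounds t1; rewrite /normalized_colat.
  have d1 := is_derive_cst (1 : R) t 1.
  have d2 := is_deriveZ (2 / pi) (is_derive1_acos t1).
  have d3 := is_deriveZ (2 / pi) (is_derive_id t (1 : R)).
  apply: is_derive_eq (is_deriveB (is_deriveB d1 d2) d3) _.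
  by rewrite /GRing.scale/=; ring.
- move=> t t1; apply: continuousM; first exact: cvg_cst.
  by apply: continuousB; [exact: continuous_inv_sqrt|exact: cvg_cst].
Qed.

Lemma normalized_colat_absmon : absmon normalized_colat.
Proof.
have p2 : 0 <= 2 / pi :> R by rewrite divr_ge0// pi_ge0.
apply: eq_absmon (absmonD normalized_colat_absmonB (absmonZ p2 (absmon_id R))).
by move=> t _; rewrite subrK.
Qed.

Lemma normalized_colat_lt1 t : `|t| < 1 -> `|normalized_colat t| < 1.
Proof.
move=> /acos_itv/andP[a0 ap]; have p0 := pi_gt0 R.
rewrite ltr_norml /normalized_colat mulrAC.
have : 0 < 2 * acos t / pi by rewrite divr_gt0// mulr_gt0.
have : 2 * acos t / pi < 2 by rewrite ltr_pdivrMr// ltr_pM2l.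
by move=> *; apply/andP; split; lra.
Qed.

(** acos t = (pi / 2) (1 - u) for the normalized angle u, so 1 / acos t is a
    geometric series in u. *)
Lemma strict_absmon_inv_acos : strict_absmon (fun t => (acos t)^-1).
Proof.
have p0 := pi_gt0 R; have p2 : 0 < 2 / pi :> R by rewrite divr_gt0.
have := strict_absmonZ p2 (strict_absmon_comp strict_absmon_geometric
  normalized_colat_absmon normalized_colat_lt1 p2 normalized_colat_absmonB).
apply: eq_strict_absmon => t /acos_itv/andP[a0 _].
rewrite /normalized_colat; move: pi_neq0 (lt0r_neq0 a0).
by move: (pi : R) (acos t) => p a pn0 an0; rewrite subKr; field; rewrite pn0 an0.
Qed.

(** The derivative is (acos t)^-1 (1 - t^2)^(-1/2), and the constant term is
    ln 2. *)
Lemma strict_absmon_log : strict_absmon (fun t => ln (pi / acos t)).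
Proof.
have p0 := pi_gt0 R.
apply: (strict_absmon_derive (strict_absmonM strict_absmon_inv_acos absmon_inv_sqrt)).
- rewrite acos0 invf_div mulrA mulrAC divff// mul1r ln_gt0//; lra.
- move=> t t1; have /andP[a0 ap] := acos_itv t1.
  have t1' := norm_lt1_bounds t1.
  have d1 := @is_derive1_comp _ (@ln R) (@acos R) t _ _ (is_derive1_ln a0) (is_derive1_acos t1').
  have d2 := is_deriveB (is_derive_cst (ln pi : R) t 1) d1.
  have -> : (acos t)^-1 * (Num.sqrt (1 - t ^+ 2))^-1 =
     0 - (acos t)^-1 * - (Num.sqrt (1 - t ^+ 2))^-1 by ring.
  have /near_in_itvoo tI : t \in `]-1, 1[ by rewrite in_itv.
  apply: near_eq_is_derive d2.
  near=> s; rewrite ln_div//; rewrite posrE.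
  have : s \in `]-1, 1[ by near: s.
  by rewrite in_itv/= -ltr_norml => /acos_itv/andP[].
- move=> t t1; have /andP[a0 ap] := acos_itv t1.
  apply: continuousM; last exact: continuous_inv_sqrt.
  apply: continuousV; first by rewrite gt_eqF.
  exact/continuous_acos/norm_lt1_bounds.
Unshelve. all: by end_near. Qed.

(** (acos t)^a = pi^a exp (- a ln (pi / acos t)). *)
Lemma strict_absmon_powN (a : R) : a < 0 -> strict_absmon (fun t => acos t `^ a).
Proof.
move=> a0; have p0 := pi_gt0 R; have a0' : 0 < - a by lra.
have pa0 : 0 < pi `^ a :> R by rewrite powR_gt0.
have := strict_absmonZ pa0 (strict_absmon_expR (strict_absmonZ a0' strict_absmon_log)).
apply: eq_strict_absmon => t /acos_itv/andP[t0 _].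
rewrite /powR !gt_eqF// -expRD; congr expR.
by rewrite ln_div ?posrE//; ring.
Qed.

(** The derivative is a (acos t)^(a-1) (1 - t^2)^(-1/2), with a negative
    exponent a - 1.  The constant pi^a, rather than (pi / 2)^a, makes the
    function nonnegative on all of [-1, 1]. *)
Lemma strict_absmon_powP (a : R) : 0 < a < 1 ->
  strict_absmon (fun t => pi `^ a - acos t `^ a).
Proof.
move=> /andP[a0 a1]; have p0 := pi_gt0 R.
have aB1 : a - 1 < 0 by lra.
apply: (strict_absmon_derive (strict_absmonZ a0 (strict_absmonM
  (strict_absmon_powN aB1) absmon_inv_sqrt))).
- by rewrite acos0 subr_gt0 gt0_ltr_powR// ?nnegrE; lra.
- move=> t t1; have /andP[t0 _] := acos_itv t1.
  have t1' := norm_lt1_bounds t1.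
  have d1 := @is_derive1_comp _ (@powR R ^~ a) (@acos R) t _ _
    (is_derive1_powR a t0) (is_derive1_acos t1').
  have d2 := is_deriveB (is_derive_cst (pi `^ a : R) t 1) d1.
  by apply: is_derive_eq d2 _; ring.
- move=> t t1; have /andP[t0 _] := acos_itv t1.
  apply: continuousM; first exact: cvg_cst.
  apply: continuousM; last exact: continuous_inv_sqrt.
  have d := @is_derive1_comp _ (@powR R ^~ (a - 1)) (@acos R) t _ _
    (is_derive1_powR (a - 1) t0) (is_derive1_acos (norm_lt1_bounds t1)).
  by apply/differentiable_continuous/derivable1_diffP; have [] := d.
Qed.

End strictly_absolutely_monotone.

(** * The arc cosine up to the endpoints *)

Section arc_cosine.
Variable R : realType.
Implicit Types (s t : R) (k : nat).

(** Power series kernels are evaluated at [radius k * t], inside the interval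
    of convergence, before k tends to infinity. *)
Definition radius k : R := 1 - k.+2%:R^-1.

Lemma radius_gt0 k : 0 < radius k.
Proof. by rewrite subr_gt0 invf_lt1// ltr1n. Qed.

Lemma radius_lt1 k : radius k < 1.
Proof. by rewrite ltrBlDr ltrDl invr_gt0. Qed.

Lemma cvg_radius : radius k @[k --> \oo] --> (1 : R).
Proof.
rewrite -[X in _ --> X]subr0; apply: cvgB; first exact: cvg_cst.
have := @cvg_harmonic R; rewrite -(cvg_shiftn 1); apply: cvg_trans.
by apply: near_eq_cvg; apply: nearW => k; rewrite /harmonic/= addn1.
Qed.

Lemma norm_radiusM k t : `|t| <= 1 -> `|radius k * t| < 1.
Proof.
move=> t1; rewrite normrM (gtr0_norm (radius_gt0 k)).
by rewrite (le_lt_trans _ (radius_lt1 k))// ler_piMr// ltW// radius_gt0.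
Qed.

Lemma acos_le s t : `|s| <= 1 -> `|t| <= 1 -> s <= t -> acos t <= acos s.
Proof.
rewrite !ler_norml => s1 t1 st; rewrite leNgt; apply/negP => ac.
have := @ltr_cos R (acos s) (acos t).
rewrite !in_itv/= !acos_ge0// !acos_lepi// => /(_ isT isT).
by rewrite ac !acosK ?in_itv//= ltNge st.
Qed.

Lemma acos_bounds t : `|t| <= 1 -> 0 <= acos t <= pi.
Proof. by rewrite ler_norml => t1; rewrite acos_ge0// acos_lepi. Qed.

Lemma acos_gt0_neq1 t : `|t| <= 1 -> t != 1 -> 0 < acos t.
Proof.
rewrite ler_norml => /andP[t0 t1] tn1.
by rewrite acos_gt0// t0 lt_neqAle tn1.
Qed.

Lemma cvg_acos_radius1 : acos (radius k) @[k --> \oo] --> (0 : R).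
Proof.
apply/cvgrPdist_lt => e e0.
have [ep|ep] := ltP pi e.
  near=> k; have : `|radius k| <= 1 by rewrite ger0_norm ltW// ?radius_gt0// radius_lt1.
  move=> /acos_bounds/andP[a0 ap]; rewrite sub0r normrN ger0_norm//.
  exact: le_lt_trans ep.
have ce : cos e < 1.
  by rewrite -(cos0 R) ltr_cos// in_itv/= ?lexx ?pi_ge0// ltW.
have /cvgrPdist_lt/(_ (1 - cos e)) := cvg_radius.
rewrite subr_gt0 => /(_ ce); apply: filterS => k /=.
rewrite (ger0_norm (_ : 0 <= 1 - radius k)); last by rewrite subr_ge0 ltW// radius_lt1.
rewrite ltrD2l ltrN2 => cr.
have r1 : `|radius k| <= 1 by rewrite ger0_norm ltW// ?radius_gt0// radius_lt1.
have /andP[a0 ap] := acos_bounds r1.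
rewrite sub0r normrN ger0_norm// ltNge; apply/negP => ea.
have : cos (acos (radius k)) <= cos e.
  rewrite leNgt; apply/negP; rewrite ltr_cos ?in_itv/= ?a0 ?ap ?(ltW e0)//.
  by rewrite ltNge ea.
rewrite acosK; last by rewrite in_itv/= -ler_norml.
by rewrite leNgt cr.
Unshelve. all: by end_near. Qed.

(** At t = 1 the limit comes from monotonicity, at t = -1 by symmetry from
    t = 1, and elsewhere from continuity. *)
Lemma cvg_acos_radius t : `|t| <= 1 ->
  acos (radius k * t) @[k --> \oo] --> acos t.
Proof.
move=> t1; have rt : radius k * t @[k --> \oo] --> t.
  by rewrite -[X in _ --> X]mul1r; apply: cvgM; [exact: cvg_radius|exact: cvg_cst].
have [tE|tn1] := eqVneq t 1.
  by rewrite tE acos1; under eq_cvg do rewrite mulr1; exact: cvg_acos_radius1.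
have [tE|tnN1] := eqVneq t (-1).
  rewrite tE acosN1 -[X in _ --> X]subr0; under eq_cvg do rewrite mulrN1.
  have : pi - acos (radius k) @[k --> \oo] --> (pi - 0 : R).
    by apply: cvgB; [exact: cvg_cst|exact: cvg_acos_radius1].
  apply: cvg_trans; apply: near_eq_cvg; apply: nearW => k.
  rewrite acosN//; have := radius_gt0 k; have := radius_lt1 k => ? ?.
  by apply/andP; split; lra.
have ct : {for t, continuous (@acos R)}; last exact: (cvg_comp _ _ rt ct).
apply: continuous_acos; move: t1; rewrite ler_norml => /andP[a b].
by rewrite !lt_neqAle a b tn1 eq_sym tnN1.
Qed.

Lemma powR_npos_le (a b c : R) : 0 < a -> a <= b -> c <= 0 -> b `^ c <= a `^ c.
Proof.
move=> a0 ab c0; rewrite -(opprK c) !(powRN _ (- c)).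
have b0 : 0 < b := lt_le_trans a0 ab.
by rewrite lef_pV2 ?posrE ?powR_gt0// ge0_ler_powR// ?nnegrE ?oppr_ge0// ltW.
Qed.

End arc_cosine.

(** * Kernels approximated from inside the unit interval *)

Section admissible_kernels.
Variable R : realType.
Implicit Types (s t : R) (k : nat).

(** H extends the power series h to the closed interval, possibly with an
    infinite value at 1.  Monotonicity and nonnegativity give
    H (r t) <= H t + H 0 for r in (0, 1), which dominates the approximation of
    the energy of H by energies of h. *)
Record admissible (h : R -> R) (H : R -> \bar R) := Admissible {
  admissible_absmon : strict_absmon h;
  admissibleE : forall t, `|t| < 1 -> H t = (h t)%:E;
  admissible_ge0 : forall t, `|t| <= 1 -> (0 <= H t)%E;
  admissible_le : forall s t, `|s| <= 1 -> `|t| <= 1 -> s <= t -> (H s <= H t)%E;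
  admissible_cvg : forall t, `|t| <= 1 ->
    (h (@radius R k * t))%:E @[k --> \oo] --> H t }.

Lemma admissible_powP (a : R) : 0 < a < 1 ->
  admissible (fun t => pi `^ a - acos t `^ a) (fun t => (pi `^ a - acos t `^ a)%:E).
Proof.
move=> a01; have /andP[a0 a1] := a01; split => //.
- exact: strict_absmon_powP.
- move=> t /acos_bounds/andP[t0 tp]; rewrite lee_fin subr_ge0.
  by apply: ge0_ler_powR; rewrite ?nnegrE ?pi_ge0// ltW.
- move=> s t s1 t1 st; rewrite lee_fin lerD2l lerN2.
  have /andP[t0 tp] := acos_bounds t1; have /andP[s0 sp] := acos_bounds s1.
  by apply: ge0_ler_powR; rewrite ?nnegrE// ?acos_le// ltW.
- move=> t t1; apply: cvg_EFin; first exact: nearW.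
  apply: cvgB; first exact: cvg_cst.
  have ct := cvg_acos_radius t1; have /andP[t0 tp] := acos_bounds t1.
  have [tE|tn0] := eqVneq (acos t) 0.
    rewrite tE in ct *; rewrite powR0 ?gt_eqF//.
    apply/cvgrPdist_lt => e e0.
    have ea0 : 0 < e `^ a^-1 by rewrite powR_gt0.
    move/cvgrPdist_lt : ct => /(_ _ ea0); apply: filterS => k /=.
    rewrite !sub0r !normrN (norm_powR _ (proj1 (andP (acos_bounds (ltW (norm_radiusM k t1)))))).
    move=> h; rewrite -[ltRHS](@powRr1 _ e) ?ltW// -(@mulVf _ a) ?gt_eqF// powRrM.
    by rewrite gt0_ltr_powR// nnegrE ltW.
  have t0' : 0 < acos t by rewrite lt_neqAle eq_sym tn0.
  suff cp : {for acos t, continuous (@powR R ^~ a)} by exact: (cvg_comp _ _ ct cp).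
  apply/differentiable_continuous/derivable1_diffP.
  by have [] := is_derive1_powR a t0'.
Qed.

Lemma geodesic_kernel_le (a s t : R) : a <= 0 -> `|s| <= 1 -> `|t| <= 1 -> s <= t ->
  (geodesic_kernel a s <= geodesic_kernel a t)%E.
Proof.
move=> a0 s1 t1 st; rewrite /geodesic_kernel a0/=.
have [tE|tn1] := eqVneq t 1; first by rewrite leey.
have sn1 : s != 1.
  by apply: contra_neq tn1 => sE; apply/eqP; rewrite eq_le (ler_normlW t1)/= -sE.
rewrite (negbTE sn1); have at0 := acos_gt0_neq1 t1 tn1.
have as0 := acos_gt0_neq1 s1 sn1; have le_ac := acos_le s1 t1 st.
case: eqP => _; rewrite lee_fin; last exact: powR_npos_le.
by rewrite ler_ln ?posrE ?divr_gt0 ?pi_gt0// ler_pM2l ?pi_gt0// lef_pV2 ?posrE.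
Qed.

Lemma geodesic_kernel_ge0 (a t : R) : `|t| <= 1 -> (0 <= geodesic_kernel a t)%E.
Proof.
move=> t1; rewrite /geodesic_kernel; case: ifP => // tP.
case: eqP => [aE|_]; last by rewrite lee_fin powR_ge0.
have tn1 : t != 1 by move: tP; rewrite aE lexx/= => /negbT.
have at0 := acos_gt0_neq1 t1 tn1; have /andP[_ tp] := acos_bounds t1.
by rewrite lee_fin ln_ge0// ler_pdivlMr// mul1r.
Qed.

(** The geodesic kernel away from its singularity at t = 1. *)
Definition geodesic_kernel_fin (a t : R) : R :=
  if a == 0 then ln (pi / acos t) else acos t `^ a.

Lemma admissible_geodesic (a : R) : a <= 0 ->
  admissible (geodesic_kernel_fin a) (geodesic_kernel a).
Proof.
move=> a0; have kE t : t != 1 -> geodesic_kernel a t = (geodesic_kernel_fin a t)%:E.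
  move=> tn1; rewrite /geodesic_kernel (negbTE tn1) andbF /geodesic_kernel_fin.
  by case: ifP.
have n1 t : `|t| < 1 -> t != 1.
  by apply: contraTneq => ->; rewrite normr1 ltxx.
split.
- rewrite /geodesic_kernel_fin; have [_|an0] := eqVneq a 0.
    exact: strict_absmon_log.
  by apply: strict_absmon_powN; rewrite lt_neqAle an0.
- by move=> t /n1/kE.
- by move=> t; exact: geodesic_kernel_ge0.
- by move=> s t; exact: geodesic_kernel_le.
- move=> t t1; have ct := cvg_acos_radius t1.
  have rt0 k : 0 < acos (radius R k * t).
    apply: acos_gt0_neq1; first exact/ltW/norm_radiusM.
    exact/n1/norm_radiusM.
  have [tE|tn1] := eqVneq t 1.
    rewrite {2}tE /geodesic_kernel a0 eqxx/=; apply/cvgeryP/cvgryPge => A.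
    have [e e0 eA] : exists2 e, 0 < e & forall b, 0 < b -> b <= e ->
       (A <= if a == 0 then ln (pi / b) else b `^ a).
      have [_|an0] := eqVneq a 0.
        exists (pi / expR A); first by rewrite divr_gt0 ?pi_gt0 ?expR_gt0.
        move=> b b0 be; rewrite -[leLHS]expRK ler_ln ?posrE ?expR_gt0 ?divr_gt0 ?pi_gt0//.
        by rewrite ler_pdivlMr// mulrC -ler_pdivlMr// expR_gt0.
      exists ((`|A| + 1) `^ a^-1); first by rewrite powR_gt0// ltr_wpDl.
      move=> b b0 be; apply: le_trans (powR_npos_le b0 be a0).
      rewrite -powRrM mulVf// powRr1; last by rewrite addr_ge0.
      by rewrite (le_trans (ler_norm A))// lerDl.
    rewrite tE acos1 in ct; move/cvgrPdist_lt : ct => /(_ _ e0).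
    apply: filterS => k /=; rewrite sub0r normrN mulr1 => h.
    have := rt0 k; rewrite tE mulr1 => r0; rewrite /geodesic_kernel_fin eA//.
    by rewrite (le_trans (ler_norm _))// ltW.
  rewrite kE//; apply: cvg_EFin; first exact: nearW.
  have at0 := acos_gt0_neq1 t1 tn1; rewrite /geodesic_kernel_fin.
  have [_|an0] := eqVneq a 0.
    have cl : {for pi / acos t, continuous (@ln R)}.
      by apply: continuous_ln; rewrite divr_gt0 ?pi_gt0.
    have cq : pi / acos (radius R k * t) @[k --> \oo] --> pi / acos t.
      apply: cvgM; first exact: cvg_cst.
      by apply: cvgV => //; rewrite gt_eqF.
    exact: (cvg_comp _ _ cq cl).
  suff cp : {for acos t, continuous (@powR R ^~ a)} by exact: (cvg_comp _ _ ct cp).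
  apply/differentiable_continuous/derivable1_diffP.
  by have [] := is_derive1_powR a at0.
Qed.

End admissible_kernels.

(** * Borel structure and translations of Euclidean space *)

Section borel.
Variable R : realType.

Lemma continuous_borel_measurable (T : ptopologicalType) (f : T -> R) :
  continuous f ->
  measurable_fun setT (f : g_sigma_algebraType (@open T) -> measurableTypeR R).
Proof.
move=> cf; apply: (measurability _ (RGenOpens.measurableE R)) => _ [U oU <-].
rewrite setTI; apply: sub_sigma_algebra.
move: cf => /continuousP; apply; have [x [y ->]] := oU.
exact: interval_open.
Qed.

Lemma measurable_coord n (i : 'I_n) :
  measurable_fun setT (fun v : borel_rV R n => (v : 'rV[R]_n) 0 i).
Proof. by apply: continuous_borel_measurable => v; exact: coord_continuous. Qed.

(** The coordinates generate the Borel sets, since [rV_cons] is measurable. *)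
Lemma measurable_rV d (T : measurableType d) n (f : T -> borel_rV R n) :
  (forall i, measurable_fun setT (fun x => (f x : 'rV[R]_n) 0 i)) ->
  measurable_fun setT f.
Proof.
elim: n f => [|n ih] f mf.
  rewrite (_ : f = cst (0 : 'rV[R]_0)); first exact: measurable_cst.
  by apply/funext => x; apply/rowP => -[].
pose tl x : borel_rV R n := \row_j (f x : 'rV[R]_n.+1) 0 (lift ord0 j).
have -> : f = @rV_cons R n \o (fun x => (tl x, (f x : 'rV[R]_n.+1) 0 0)).
  apply/funext => x; apply/rowP => i /=.
  case: (unliftP ord0 i) => [j|] ->; last by rewrite rV_cons0.
  by rewrite rV_consS mxE.
apply: measurableT_comp; first exact: measurable_rV_cons.
apply: measurable_fun_pair; last exact: mf.
by apply: ih => i; under eq_fun do rewrite mxE; exact: mf.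
Qed.

End borel.

Section translation.
Variable R : realType.
Local Open Scope ereal_scope.

Lemma lebesgue_measure_translation (a : R) (A : set (measurableTypeR R)) :
  measurable A -> lebesgue_measure ((fun x : R => x + a)%R @^-1` A) = lebesgue_measure A.
Proof.
move=> mA; have mT : measurable_fun setT
    ((fun x : R => x + a)%R : measurableTypeR R -> measurableTypeR R).
  exact: measurable_funD.
rewrite -[LHS]/(pushforward lebesgue_measure
  ((fun x : R => x + a)%R : measurableTypeR R -> measurableTypeR R) A).
apply/esym/lebesgue_measure_unique => //= _ [[b c]] _ <-.
rewrite /pushforward (_ : _ @^-1` _ = `](b - a)%R, (c - a)%R]%classic); last first.
  by apply/seteqP; split=> x /=; rewrite !in_itv/= ltrBlDr lerBrDr.
rewrite !lebesgue_measure_itv/= !lte_fin ltrBlDr subrK.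
by case: ifP => // _; rewrite -!EFinB; congr EFin; ring.
Qed.

Definition translate n (a : 'rV[R]_n) (v : borel_rV R n) : borel_rV R n :=
  ((v : 'rV[R]_n) + a)%R.

Lemma measurable_translate n (a : 'rV[R]_n) : measurable_fun setT (translate a).
Proof.
apply: measurable_rV => i; under eq_fun do rewrite mxE.
by apply: measurable_funD => //; exact: measurable_coord.
Qed.

Lemma translate_rV_cons n (a : 'rV[R]_n.+1) (v : borel_rV R n) (x : measurableTypeR R) :
  translate a (rV_cons (v, x)) =
  rV_cons (translate (\row_j a ord0 (lift ord0 j)) v, (x : R) + a ord0 ord0)%R.
Proof.
apply/rowP => i; rewrite mxE; case: (unliftP ord0 i) => [j|] ->.
  by rewrite !rV_consS !mxE.
by rewrite !rV_cons0.
Qed.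

(** One coordinate at a time: sections along the first coordinate are moved by
    the one-dimensional translation, and the remaining ones by induction. *)
Lemma lebesgue_rV_translate n (a : 'rV[R]_n) (A : set (borel_rV R n)) :
  measurable A -> lebesgue_rV R n (translate a @^-1` A) = lebesgue_rV R n A.
Proof.
elim: n a A => [|n ih] a A mA.
  congr (lebesgue_rV _ _ _); apply/seteqP; split=> v /=;
    by rewrite (_ : translate a v = v)//; apply/rowP => -[].
pose a' : 'rV[R]_n := \row_j a ord0 (lift ord0 j).
have mB : measurable (@rV_cons R n @^-1` A).
  by rewrite -[X in measurable X]setTI; exact: measurable_rV_cons.
have mphi := @measurable_fun_xsection _ _ _ _ R (@lebesgue_measure R) _ mB.
rewrite /= /lebesgue_rV_step /pushforward /product_measure1.
set phi := lebesgue_measure \o xsection (_ @^-1` A) in mphi *.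
transitivity (\int[lebesgue_rV R n]_v (phi \o translate a') v).
  apply: eq_integral => v _; rewrite /phi /=.
  rewrite -[RHS](lebesgue_measure_translation (a ord0 ord0)); last exact: measurable_xsection.
  congr lebesgue_measure; apply/seteqP.
  by split=> x /=; rewrite /xsection /preimage /= !inE /= translate_rV_cons.
rewrite -[LHS](@ge0_integral_pushforward _ _ _ _ _ _ (measurable_translate a') _ setT)//.
apply: eq_measure_integral => [|mT B mB2 _]; first exact: measurable_translate.
exact: ih.
Qed.

End translation.

(** * Orthogonal invariance of Lebesgue measure *)

Section lebesgue_rV_sigma_finite.
Variables (R : realType) (n : nat).
Local Open Scope ereal_scope.

(** Lebesgue measure under a name that can carry the sigma-finite structure
    required by the Tonelli theorem. *)
Definition lebesgue_rV_fun : set (borel_rV R n) -> \bar R := lebesgue_rV R n.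

HB.instance Definition _ := Measure.copy lebesgue_rV_fun
  (lebesgue_rV R n : {measure set _ -> \bar R}).

Lemma lebesgue_rV_fun_sigma_finite : sigma_finite setT lebesgue_rV_fun.
Proof.
exists (fun k : nat => [set v | forall i, - k%:R <= (v : 'rV[R]_n) ord0 i <= k%:R]%R).
  apply/esym/seteqP; split => // v _.
  exists (Num.bound (\sum_(i < n) `|(v : 'rV[R]_n) ord0 i|))%R => // i /=.
  rewrite -ler_norml ltW//.
  apply: le_lt_trans (archi_boundP _); last exact: sumr_ge0.
  by rewrite (bigD1 i)//= lerDl; exact: sumr_ge0.
move=> k; split; first exact: measurable_rV_box.
have kk : (- k%:R <= k%:R :> R)%R by have := ler0n R k; lra.
by rewrite /lebesgue_rV_fun lebesgue_rV_box// ltry.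
Qed.

HB.instance Definition _ := Measure_isSigmaFinite.Build _ _ _ lebesgue_rV_fun
  lebesgue_rV_fun_sigma_finite.

End lebesgue_rV_sigma_finite.

Lemma integral_section_swap d (T : measurableType d) (R : realType)
    (mu : {sigma_finite_measure set T -> \bar R}) (S : set (T * T)) :
  measurable S ->
  (\int[mu]_x mu (xsection S x) = \int[mu]_y mu (ysection S y))%E.
Proof.
move=> mS; have := @indic_fubini_tonelli _ _ _ _ R mu mu S mS.
by rewrite indic_fubini_tonelli_FE// indic_fubini_tonelli_GE.
Qed.

Section orthogonal.
Variables (R : realType) (d : nat) (T : 'rV[R]_d.+1 -> 'rV[R]_d.+1).
Hypothesis TK : involutive T.
Hypothesis TD : {morph T : u v / u + v}.
Hypothesis TZ : forall (r : R) v, T (r *: v) = r *: T v.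
Hypothesis Tdot : forall u v, dotrv (T u) (T v) = dotrv u v.
Hypothesis Tcont : continuous T.

Local Notation V := (borel_rV R d.+1).

Variable mu : {sigma_finite_measure set V -> \bar R}.
Hypothesis mu_translate : forall a (A : set V), measurable A ->
  mu (translate a @^-1` A) = mu A.
Hypothesis mu_ball : (0 < mu (cone setT) < +oo)%E.

Let TN v : T (- v) = - T v.
Proof. by rewrite -[in LHS]scaleN1r TZ scaleN1r. Qed.

Lemma measurable_orthogonal : measurable_fun setT (T : V -> V).
Proof.
apply: measurable_rV => i; apply: continuous_borel_measurable => v.
apply: (@continuous_comp _ _ _ T (fun w : 'rV[R]_d.+1 => w 0 i)).
  exact: Tcont.
exact: coord_continuous.
Qed.

Let mpre (f : V -> V) (A : set V) : measurable_fun setT f -> measurable A ->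
  measurable (f @^-1` A).
Proof. by move=> mf mA; rewrite -[X in measurable X]setTI; exact: mf. Qed.

Let mpre2 (f : V * V -> V) (A : set V) : measurable_fun setT f -> measurable A ->
  measurable (f @^-1` A).
Proof. by move=> mf mA; rewrite -[X in measurable X]setTI; exact: mf. Qed.

Let B : set V := cone setT.

Let BE (v : 'rV[R]_d.+1) : B v <-> 0 < dotrv v v <= 1.
Proof.
split; last exact: cone_setT.
move=> [x [r [_ /andP[r0 r1] ->]]].
by rewrite dotrvZ dotrv_sphere mulr1 exprn_gt0//= expr_le1// ltW.
Qed.

Let mB : measurable B.
Proof. by apply: (@measurable_cone R d setT); exact: measurableT. Qed.

Let dotrvN (v : 'rV[R]_d.+1) : dotrv (- v) (- v) = dotrv v v.
Proof. by rewrite -scaleN1r dotrvZ sqrrN expr1n mul1r. Qed.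

(** Let B be the punctured unit ball and integrate 1_A(T x + y) 1_B(y) in both orders.
    Integrating in x first, the translation x -> x + T y turns the result into
    mu(T^-1 A) mu(B).  Integrating in y first, the translation y -> y - T x
    leads to the integral of 1_A(y) 1_B(y - T x), whose integral in x is mu(B)
    for each y in A because B is symmetric and preserved by T.  Hence the result
    is also mu(A) mu(B). *)
Lemma measure_orthogonal (A : set V) : measurable A ->
  mu (T @^-1` A) = mu A.
Proof.
move=> mA.
pose S1 : set (V * V) := [set p | A (T p.1 + p.2) /\ B p.2].
pose S2 : set (V * V) := [set p | A p.2 /\ B (p.2 - T p.1)].
have mT := measurable_orthogonal.
have madd : measurable_fun setT
    (fun p : V * V => (T p.1 + (p.2 : 'rV[R]_d.+1)) : V).
  apply: measurable_rV => i; under eq_fun do rewrite mxE.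
  apply: measurable_funD.
    apply: (@measurableT_comp _ _ _ _ _ _ (fun v : V => (v : 'rV[R]_d.+1) 0 i)).
      exact: measurable_coord.
    exact: measurableT_comp mT _.
  apply: (@measurableT_comp _ _ _ _ _ _ (fun v : V => (v : 'rV[R]_d.+1) 0 i)) => //.
  exact: measurable_coord.
have msub : measurable_fun setT
    (fun p : V * V => ((p.2 : 'rV[R]_d.+1) - T p.1) : V).
  apply: measurable_rV => i; under eq_fun do rewrite !mxE.
  apply: measurable_funB.
    apply: (@measurableT_comp _ _ _ _ _ _ (fun v : V => (v : 'rV[R]_d.+1) 0 i)) => //.
    exact: measurable_coord.
  apply: (@measurableT_comp _ _ _ _ _ _ (fun v : V => (v : 'rV[R]_d.+1) 0 i)).
    exact: measurable_coord.
  exact: measurableT_comp mT _.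
have mS1 : measurable S1.
  by apply: measurableI; apply: mpre2.
have mS2 : measurable S2.
  by apply: measurableI; apply: mpre2.
(* T (x + T y) = T x + y, as T is an involution. *)
have e1 y : mu (ysection S1 y) = (mu (T @^-1` A) * (\1_B y)%:E)%E.
  have [By|By] := pselect (B y).
    rewrite indicE mem_set// mule1.
    rewrite -[RHS](mu_translate (T y)); last exact: mpre.
    congr (mu _); apply/seteqP; split=> x; rewrite /ysection/= !inE/= /translate TD TK.
      by case.
    by [].
  rewrite indicE memNset// mule0 (_ : ysection _ _ = set0) ?measure0//.
  by apply/seteqP; split=> x //; rewrite /ysection/= inE => -[].
have e12 x : mu (xsection S1 x) = mu (xsection S2 x).
  rewrite -[RHS](mu_translate (T x)); last exact: measurable_xsection.
  congr (mu _); apply/seteqP; split=> y;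
    by rewrite /xsection/= !inE /S1 /S2/= /translate addrK [T x + _]addrC.
(* y - T x lies in B when x - T y does, by applying T and a change of sign. *)
have e2 y : mu (ysection S2 y) = (mu B * (\1_A y)%:E)%E.
  have [Ay|Ay] := pselect (A y).
    rewrite indicE mem_set// mule1.
    rewrite -[RHS](mu_translate (- T y)); last exact: mB.
    congr (mu _); apply/seteqP; split=> x; rewrite /ysection/= !inE/= /translate /=.
      by move=> [_ /BE]; rewrite -Tdot TD TN TK -dotrvN opprB => h; apply/BE.
    move=> /BE h; split=> //; apply/BE.
    by rewrite -Tdot TD TN TK -dotrvN opprB.
  rewrite indicE memNset// mule0 (_ : ysection _ _ = set0) ?measure0//.
  by apply/seteqP; split=> x //; rewrite /ysection/= inE => -[].
have := integral_section_swap mu mS1.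
under eq_integral do rewrite e12.
rewrite integral_section_swap//.
under eq_integral do rewrite e2.
under [in RHS]eq_integral do rewrite e1.
have intI (c : \bar R) (E : set V) : (0 <= c)%E -> measurable E ->
    (\int[mu]_y (c * (\1_E y)%:E) = c * mu E)%E.
  move=> c0 mE; rewrite ge0_integralZl//.
    by rewrite integral_indic// setIT.
  exact/measurable_EFinP.
rewrite !intI// [RHS]muleC => /eqP.
have /andP[B0 Boo] := mu_ball.
have Bfin : mu B \is a fin_num by rewrite ge0_fin_numE// ltW.
rewrite eq_le !lee_pmul2l// -eq_le.
by move=> /eqP/esym.
Qed.

End orthogonal.

Lemma lebesgue_rV_orthogonal (R : realType) (d : nat)
    (T : 'rV[R]_d.+1 -> 'rV[R]_d.+1) (A : set (borel_rV R d.+1)) :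
  involutive T -> {morph T : u v / u + v} ->
  (forall (r : R) v, T (r *: v) = r *: T v) ->
  (forall u v, dotrv (T u) (T v) = dotrv u v) -> continuous T ->
  measurable A -> lebesgue_rV R d.+1 (T @^-1` A) = lebesgue_rV R d.+1 A.
Proof.
move=> TK TD TZ Tdot Tcont mA.
have h0 : (0 < lebesgue_rV_fun (cone [set: sphere R d]) < +oo)%E.
  have /andP[] := surface_measure_setT R d; rewrite /surface_measure => h0 hoo.
  apply/andP; split.
    rewrite lt0e measure_ge0 andbT; apply: contraTneq h0.
    by rewrite /lebesgue_rV_fun => ->; rewrite mule0 ltxx.
  rewrite ltey; apply: contraTneq hoo; rewrite /lebesgue_rV_fun => ->.
  by rewrite mulry gtr0_sg// mul1e ltxx.
exact: (@measure_orthogonal R d T TK TD TZ Tdot Tcont (@lebesgue_rV_fun R d.+1)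
  (fun a A mA => lebesgue_rV_translate a mA) h0 A mA).
Qed.
(** * Reflections of the sphere *)

Section sphere_geometry.
Variables (R : realType) (d : nat).
Implicit Types (x y : sphere R d) (u v w : 'rV[R]_d.+1).

Lemma dotrvC u v : dotrv u v = dotrv v u.
Proof. by apply: eq_bigr => i _; rewrite mulrC. Qed.

Lemma dotrvDl u v w : dotrv (u + v) w = dotrv u w + dotrv v w.
Proof. by rewrite -big_split; apply: eq_bigr => i _; rewrite mxE mulrDl. Qed.

Lemma dotrvZl (r : R) u v : dotrv (r *: u) v = r * dotrv u v.
Proof. by rewrite mulr_sumr; apply: eq_bigr => i _; rewrite mxE mulrA. Qed.

Lemma dotrvNl u v : dotrv (- u) v = - dotrv u v.
Proof. by rewrite -scaleN1r dotrvZl mulN1r. Qed.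

Lemma dotrvDr u v w : dotrv u (v + w) = dotrv u v + dotrv u w.
Proof. by rewrite !(dotrvC u) dotrvDl. Qed.

Lemma dotrvZr (r : R) u v : dotrv u (r *: v) = r * dotrv u v.
Proof. by rewrite !(dotrvC u) dotrvZl. Qed.

Lemma dotrvNr u v : dotrv u (- v) = - dotrv u v.
Proof. by rewrite !(dotrvC u) dotrvNl. Qed.

Lemma dotrv_ge0 u : 0 <= dotrv u u.
Proof. by apply: sumr_ge0 => i _; exact: sqr_ge0. Qed.

Lemma dotrv_eq0 u : (dotrv u u == 0) = (u == 0).
Proof.
apply/idP/eqP => [|->]; last by rewrite /dotrv big1// => i _; rewrite mxE mul0r.
rewrite psumr_eq0; last by move=> i _; exact: sqr_ge0.
move=> /allP u0; apply/rowP => i; rewrite mxE.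
by have := u0 i; rewrite mem_index_enum => /(_ isT) /=; rewrite mulf_eq0 orbb => /eqP.
Qed.

Lemma dotrv_sphere_norm_le1 x y : `|dotrv (sphere_val x) (sphere_val y)| <= 1.
Proof.
have := dotrv_ge0 (sphere_val x - sphere_val y).
have := dotrv_ge0 (sphere_val x + sphere_val y).
rewrite !(dotrvDl, dotrvDr, dotrvNl, dotrvNr, dotrv_sphere).
rewrite (dotrvC (sphere_val y)) ler_norml => h1 h2.
by apply/andP; split; lra.
Qed.

Lemma continuous_sphere_val : continuous (@sphere_val R d).
Proof. exact: initial_continuous. Qed.

Lemma continuous_sphere_coord (i : 'I_d.+1) :
  continuous (fun x => sphere_val x ord0 i).
Proof.
move=> x; apply: (@continuous_comp _ _ _ (@sphere_val R d) (fun v : 'rV[R]_d.+1 => v ord0 i)).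
  exact: continuous_sphere_val.
exact: coord_continuous.
Qed.

Lemma measurable_sphere_coord (i : 'I_d.+1) :
  measurable_fun setT (fun x : borel_sphere R d => sphere_val x ord0 i).
Proof.
exact: (@continuous_borel_measurable R (sphere R d) _ (@continuous_sphere_coord i)).
Qed.

Lemma measurable_dotrv_sphere :
  measurable_fun setT (fun p : borel_sphere R d * borel_sphere R d =>
    dotrv (sphere_val p.1) (sphere_val p.2)).
Proof.
apply: measurable_sum => i; apply: measurable_funM.
  exact: (measurableT_comp (measurable_sphere_coord i) measurable_fst).
exact: (measurableT_comp (measurable_sphere_coord i) measurable_snd).
Qed.

(** The reflection in the hyperplane orthogonal to w. *)
Definition householder w v := v - (2 * dotrv v w / dotrv w w) *: w.

Section householder_theory.
Variable w : 'rV[R]_d.+1.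

Lemma householderD : {morph householder w : u v / u + v}.
Proof.
move=> u v; rewrite /householder dotrvDl mulrDr mulrDl scalerDl opprD.
by rewrite addrACA.
Qed.

Lemma householderZ (r : R) v : householder w (r *: v) = r *: householder w v.
Proof.
rewrite /householder dotrvZl scalerBr scalerA; congr (_ - _ *: _); ring.
Qed.

Lemma householder_dotrv u v : dotrv (householder w u) (householder w v) = dotrv u v.
Proof.
rewrite /householder !(dotrvDl, dotrvDr, dotrvNl, dotrvNr, dotrvZl, dotrvZr).
rewrite (dotrvC w v).
have [->|w0] := eqVneq (dotrv w w) 0; first by rewrite invr0 !(mulr0, mul0r); ring.
by field.
Qed.

(** For w = 0 the quotient is 0 and the reflection is the identity. *)
Lemma householderK : involutive (householder w).
Proof.
move=> v; have [w0|w0] := eqVneq (dotrv w w) 0.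
  by rewrite /householder w0 invr0 !mulr0 !scale0r !subr0.
have hw : dotrv (householder w v) w = - dotrv v w.
  by rewrite /householder dotrvDl dotrvNl dotrvZl; field.
by rewrite {1}/householder hw mulrN mulNr scaleNr opprK /householder subrK.
Qed.

Lemma continuous_householder : continuous (householder w).
Proof.
have cdot : continuous (fun v => dotrv v w).
  apply: continuous_big; first exact: add_continuous.
  move=> i _ u; apply: cvgM; first exact: (nbhs_filter u).
    exact: coord_continuous.
  exact: (@cvg_cst _ _ _ (nbhs u) (nbhs_filter u)).
move=> v; apply: (@cvgB R 'rV[R]_d.+1 _ (nbhs v)); first exact: cvg_id.
apply: (@cvgZ R 'rV[R]_d.+1 _ (nbhs v) (nbhs_filter v)); last first.
  exact: (@cvg_cst _ _ _ (nbhs v) (nbhs_filter v)).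
apply: (@cvgM R _ (nbhs v) (nbhs_filter v)); last first.
  exact: (@cvg_cst _ _ _ (nbhs v) (nbhs_filter v)).
apply: (@cvgM R _ (nbhs v) (nbhs_filter v)); last exact: cdot.
exact: (@cvg_cst _ _ _ (nbhs v) (nbhs_filter v)).
Qed.

End householder_theory.

(** Reflections alone act transitively on the sphere, so no other rotation is
    needed to exploit the symmetry of the surface measure. *)
Lemma householder_swap x y :
  householder (sphere_val x - sphere_val y) (sphere_val x) = sphere_val y.
Proof.
rewrite /householder; set w := sphere_val x - sphere_val y.
have [w0|w0] := eqVneq (dotrv w w) 0.
  have /eqP wE : w == 0 by rewrite -dotrv_eq0; apply/eqP.
  have -> : sphere_val y = sphere_val x - w by rewrite /w subKr.
  by rewrite wE scaler0.
rewrite (_ : 2 * _ / _ = 1); first by rewrite scale1r /w subKr.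
move: w0; rewrite /w !(dotrvDl, dotrvDr, dotrvNl, dotrvNr, dotrv_sphere).
rewrite (dotrvC (sphere_val y)); set a := dotrv _ _.

have -> : 1 - a + (- a - -1) = 2 * (1 - a) by ring.
by move=> w0; rewrite divff.
Qed.

Section sphere_map.
Variable w : 'rV[R]_d.+1.

Definition sphere_reflection (x : borel_sphere R d) : borel_sphere R d :=
  insubd (point : sphere R d) (householder w (sphere_val x)).

Lemma sphere_reflectionE x :
  sphere_val (sphere_reflection x) = householder w (sphere_val x).
Proof.
rewrite /sphere_val /sphere_reflection val_insubd ifT//; apply/mem_set.
by rewrite /sphere_set/= householder_dotrv dotrv_sphere.
Qed.

Lemma sphere_reflectionK : involutive sphere_reflection.
Proof.
move=> x; apply: val_inj; rewrite -[LHS]/(sphere_val _) !sphere_reflectionE.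
by rewrite householderK.
Qed.

Lemma measurable_sphere_reflection : measurable_fun setT sphere_reflection.
Proof.
apply: (@measurability _ _ _ (borel_sphere R d) setT sphere_reflection
  (@open (sphere R d)) erefl) => _ [_ [W oW <-] <-].
rewrite setTI; apply: sub_sigma_algebra.
exists (householder w @^-1` W).
  by move: (@continuous_householder w) => /continuousP; exact.
by apply/seteqP; split=> x /=;
  rewrite -[set_val (sphere_reflection x)]/(sphere_val _) sphere_reflectionE.
Qed.

(** Taking cones commutes with linear maps, which reduces the claim to Lebesgue
    measure. *)
Lemma sigma_sphere_reflection (A : set (borel_sphere R d)) : measurable A ->
  sigma_sphere (sphere_reflection @^-1` A) = sigma_sphere A.
Proof.
move=> mA; rewrite /sigma_sphere /surface_measure; congr (_ * (_ * _))%E.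
rewrite -[RHS](lebesgue_rV_orthogonal (@householderK w) (@householderD w)
  (@householderZ w) (@householder_dotrv w) (@continuous_householder w));
  last exact: measurable_cone.
congr (lebesgue_rV _ _ _); apply/seteqP; split=> v /=.
  move=> [x [r [Ax r01 ->]]]; exists (sphere_reflection x), r; split=> //.
  by rewrite householderZ sphere_reflectionE.
move=> [y [r [Ay r01 vE]]]; exists (sphere_reflection y), r; split=> //.
  by rewrite /= sphere_reflectionK.
by rewrite sphere_reflectionE -householderZ -vE householderK.
Qed.

End sphere_map.

(** A reflection that exchanges y and z preserves the measure and the inner
    product. *)
Lemma sigma_sphere_zonal (g : R -> \bar R) (y z : sphere R d) :
  measurable_fun setT (fun x : borel_sphere R d => g (dotrv (sphere_val x) (sphere_val y))) ->
  (forall t, (`|t| <= 1)%R -> 0 <= g t)%E ->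
  (\int[@sigma_sphere R d]_x g (dotrv (sphere_val x) (sphere_val y)) =
   \int[@sigma_sphere R d]_x g (dotrv (sphere_val x) (sphere_val z)))%E.
Proof.
move=> mg g0; pose w := sphere_val z - sphere_val y.
have mr := @measurable_sphere_reflection w.
transitivity (\int[pushforward (@sigma_sphere R d) (sphere_reflection w)]_x
   g (dotrv (sphere_val x) (sphere_val y)))%E.
  apply: eq_measure_integral => A mA _.
  by rewrite /= /pushforward sigma_sphere_reflection.
rewrite ge0_integral_pushforward//; last first.
  by move=> x _; exact/g0/dotrv_sphere_norm_le1.
apply: eq_integral => x _ /=.
have hy : sphere_val y = householder w (sphere_val z) by rewrite householder_swap.
by rewrite sphere_reflectionE hy householder_dotrv.
Qed.

End sphere_geometry.

(** * Moments and energies of powers of the inner product *)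

Section product_integrals.
Context d1 d2 (T1 : measurableType d1) (T2 : measurableType d2) (R : realType).
Variables (P : probability T1 R) (Q : probability T2 R).

Lemma product_probability_setT : ((P \x Q) setT = 1)%E.
Proof.
rewrite -setXTT product_measure1E// -[RHS]mule1.
congr (_ * _)%E; exact: probability_setT.
Qed.

Lemma product_probability_lty : ((P \x Q) setT < +oo)%E.
Proof. by rewrite product_probability_setT ltry. Qed.

Lemma Rintegral_product (a : T1 -> R) (b : T2 -> R) (A B : R) :
  measurable_fun setT a -> measurable_fun setT b ->
  (forall x, `|a x| <= A) -> (forall y, `|b y| <= B) ->
  \int[(P \x Q)%E]_p (a p.1 * b p.2) = (\int[P]_x a x) * (\int[Q]_y b y).
Proof.
move=> ma mb aA bB.
have mab : measurable_fun setT (fun p : T1 * T2 => a p.1 * b p.2).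
  by apply: measurable_funM; [exact: (measurableT_comp ma)|exact: (measurableT_comp mb)].
have iab : (P \x Q)%E.-integrable setT (EFin \o (fun p => a p.1 * b p.2)).
  apply: (@bounded_integrable _ _ _ _ _ measurableT product_probability_lty _ (A * B)) => //.
  by move=> p _; rewrite normrM ler_pM.
have PT : (P setT < +oo)%E by rewrite probability_setT ltry.
have QT : (Q setT < +oo)%E by rewrite probability_setT ltry.
have ib : Q.-integrable setT (EFin \o b).
  exact: (@bounded_integrable _ _ _ _ _ measurableT QT _ B).
have ia : P.-integrable setT (EFin \o a).
  exact: (@bounded_integrable _ _ _ _ _ measurableT PT _ A).
have iE x : (\int[Q]_y (a x * b y)%:E = (a x * \int[Q]_y b y)%:E)%E.
  under eq_integral do rewrite EFinM.
  by rewrite integralZl// EFinM /Rintegral fineK//; exact: integrable_fin_num.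
rewrite [LHS]/Rintegral -(integral12_prod_meas1 iab) -RintegralZr//.
by congr fine; apply: eq_integral => x _; exact: iE.
Qed.

End product_integrals.

Lemma Rintegral_sum d (T : measurableType d) (R : realType)
    (mu : {measure set T -> \bar R}) (I : Type) (s : seq I) (F : I -> T -> R) :
  (forall i, mu.-integrable setT (EFin \o F i)) ->
  \int[mu]_x (\sum_(i <- s) F i x) = \sum_(i <- s) \int[mu]_x F i x.
Proof.
move=> iF; rewrite /Rintegral.
under eq_integral do rewrite -sumEFin.
rewrite integral_sum//.
elim: s => [|i s ih]; first by rewrite !big_nil.
rewrite !big_cons fineD; first by rewrite ih.
  exact: (integrable_fin_num measurableT (iF i)).
rewrite sum_fin_num; elim: s {ih} => //= j s ->; rewrite andbT.
exact: (integrable_fin_num measurableT (iF j)).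
Qed.

Section moments.
Variables (R : realType) (d : nat).
Local Notation S := (borel_sphere R d).
Local Notation sigma := (@sigma_sphere R d).
Implicit Types (mu nu : probability S R) (p : S * S).

Definition sphere_dot p : R := dotrv (sphere_val p.1) (sphere_val p.2).

Lemma measurable_sphere_dot : measurable_fun setT sphere_dot.
Proof. exact: measurable_dotrv_sphere. Qed.

Lemma norm_sphere_dot p : `|sphere_dot p| <= 1.
Proof. exact: dotrv_sphere_norm_le1. Qed.

(** Monomials are indexed by maps from factors to coordinates, with repetitions,
    which avoids multinomial coefficients. *)
Definition sphere_monomial n (alpha : {ffun 'I_n -> 'I_d.+1}) (x : S) : R :=
  \prod_(i < n) sphere_val x ord0 (alpha i).

Definition moment mu n (alpha : {ffun 'I_n -> 'I_d.+1}) : R :=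
  \int[mu]_x sphere_monomial alpha x.

Lemma norm_sphere_coord (x : S) i : `|sphere_val x ord0 i| <= 1.
Proof.
rewrite -(@expr_le1 _ 2)// real_normK ?num_real//.
rewrite -(dotrv_sphere x) /dotrv (bigD1 i)//= expr2 lerDl.
by apply: sumr_ge0 => j _; exact: sqr_ge0.
Qed.

Lemma norm_sphere_monomial n (alpha : {ffun 'I_n -> 'I_d.+1}) x :
  `|sphere_monomial alpha x| <= 1.
Proof.
rewrite /sphere_monomial normr_prod; apply: prodr_ile1 => i _.
by rewrite normr_ge0 norm_sphere_coord.
Qed.

Lemma measurable_sphere_monomial n (alpha : {ffun 'I_n -> 'I_d.+1}) :
  measurable_fun setT (sphere_monomial alpha).
Proof. by apply: measurable_prod => i _; exact: measurable_sphere_coord. Qed.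

(** Expanding the power of the sum separates the two variables: this is why
    powers of the inner product are positive definite. *)
Lemma sphere_dotX n p : sphere_dot p ^+ n =
  \sum_(alpha : {ffun 'I_n -> 'I_d.+1}) sphere_monomial alpha p.1 * sphere_monomial alpha p.2.
Proof.
rewrite -[in LHS](card_ord n) -prodr_const /sphere_dot /dotrv.
rewrite (bigA_distr_bigA (fun (_ : 'I_n) j => sphere_val p.1 0 j * sphere_val p.2 0 j)).
by apply: eq_bigr => alpha _; rewrite -big_split.
Qed.

Lemma integral_sphere_dotX mu nu n :
  \int[(mu \x nu)%E]_p (sphere_dot p ^+ n) =
  \sum_(alpha : {ffun 'I_n -> 'I_d.+1}) moment mu alpha * moment nu alpha.
Proof.
under eq_Rintegral do rewrite sphere_dotX.
rewrite Rintegral_sum; last first.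
  move=> alpha; apply: (@bounded_integrable _ _ _ _ _ measurableT
    (product_probability_lty mu nu) _ 1).
    by apply: measurable_funM;
      apply: (measurableT_comp (measurable_sphere_monomial alpha)).
  move=> p _; rewrite normrM -[leRHS]mulr1.
  by rewrite ler_pM// norm_sphere_monomial.
apply: eq_bigr => alpha _.
by apply: (@Rintegral_product _ _ _ _ _ _ _ _ _ 1 1);
  [exact: measurable_sphere_monomial|exact: measurable_sphere_monomial
  |exact: norm_sphere_monomial|exact: norm_sphere_monomial].
Qed.

Lemma sigma_sphere_zonalX n (y z : S) :
  \int[sigma]_x (sphere_dot (x, y) ^+ n) = \int[sigma]_x (sphere_dot (x, z) ^+ n).
Proof.
(* The shift by 1 makes the integrand nonnegative on the sphere. *)
pose g (t : R) : \bar R := (`|t ^+ n + 1|)%:E.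
have mD w : measurable_fun setT (fun x : S => sphere_dot (x, w)).
  by apply: (measurableT_comp measurable_sphere_dot); exact: measurable_pair2.
have ge0 w x : 0 <= sphere_dot (x, w) ^+ n + 1.
  have : `|sphere_dot (x, w) ^+ n| <= 1.
    by rewrite normrX exprn_ile1// norm_sphere_dot.
  by rewrite ler_norml => /andP[? _]; lra.
have iD w : sigma.-integrable setT (EFin \o (fun x => sphere_dot (x, w) ^+ n)).
  have sT : (sigma setT < +oo)%E by rewrite probability_setT ltry.
  apply: (@bounded_integrable _ _ _ _ _ measurableT sT _ 1).
    exact: measurable_funX.
  by move=> x _; rewrite normrX exprn_ile1// norm_sphere_dot.
have gE w : (\int[sigma]_x g (sphere_dot (x, w)) =
    (\int[sigma]_x (sphere_dot (x, w) ^+ n))%:E + 1)%E.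
  rewrite /g; under eq_integral do rewrite ger0_norm// EFinD.
  rewrite integralD//; [|exact: iD|]; last first.
    by apply: (@bounded_integrable _ _ _ _ _ measurableT _ (cst 1) 1) => //=;
      [rewrite probability_setT ltry|move=> *; rewrite normr1].
  rewrite [X in (_ + X)%E](_ : _ = 1%E); last first.
    apply: etrans (integral_cst sigma measurableT 1%E) _.
    by rewrite mul1e; exact: probability_setT.
  rewrite /Rintegral fineK//.
  exact: (integrable_fin_num measurableT (iD w)).
have H : (\int[sigma]_x g (sphere_dot (x, y)) = \int[sigma]_x g (sphere_dot (x, z)))%E.
  apply: (@sigma_sphere_zonal R d g y z); last by move=> t _; rewrite lee_fin.
  apply/measurable_EFinP; apply: measurableT_comp => //.
  by apply: measurable_funD => //; apply: measurable_funX; exact: mD.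
move: H; rewrite !gE => /eqP; rewrite -!EFinD eqe => /eqP.
exact: addIr.
Qed.

(** By symmetry the integral over the first variable is a constant, which any
    probability measure in the second variable leaves unchanged. *)
Lemma sphere_dotX_cross mu n :
  \int[(sigma \x mu)%E]_p (sphere_dot p ^+ n) = \int[(sigma \x sigma)%E]_p (sphere_dot p ^+ n).
Proof.
suff E nu : \int[(sigma \x nu)%E]_p (sphere_dot p ^+ n) =
    \int[sigma]_x (sphere_dot (x, point) ^+ n) by rewrite !E.
have iD : (sigma \x nu)%E.-integrable setT (EFin \o (fun p => sphere_dot p ^+ n)).
  apply: (@bounded_integrable _ _ _ _ _ measurableT (product_probability_lty _ _) _ 1).
    by apply: measurable_funX; exact: measurable_sphere_dot.
  by move=> p _; rewrite normrX exprn_ile1// norm_sphere_dot.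
rewrite {1}/Rintegral -(integral21_prod_meas1 iD) /fubini_G /=.
have sT : (sigma setT < +oo)%E by rewrite probability_setT ltry.
have mD w : measurable_fun setT (fun x : S => sphere_dot (x, w)).
  by apply: (measurableT_comp measurable_sphere_dot); exact: measurable_pair2.
have iE (y : S) : (\int[sigma]_x (sphere_dot (x, y) ^+ n)%:E =
    (\int[sigma]_x (sphere_dot (x, point) ^+ n))%:E)%E.
  rewrite -(sigma_sphere_zonalX n y point) /Rintegral fineK//.
  apply: (integrable_fin_num measurableT).
  apply: (@bounded_integrable _ _ _ _ _ measurableT sT (fun x => sphere_dot (x, y) ^+ n) 1).
    exact: measurable_funX.
  by move=> x _; rewrite normrX exprn_ile1// norm_sphere_dot.
under eq_integral do rewrite iE.
by rewrite integral_cst//= probability_setT mule1.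
Qed.

(** Write m and s for the moments of mu and of the surface measure.  Symmetry
    makes the sum of the products s m equal to the sum of the squares of s,
    hence the sum of (m - s)^2 is the sum of m^2 minus the sum of s^2. *)
Lemma moment_gap mu n :
  \int[(mu \x mu)%E]_p (sphere_dot p ^+ n) - \int[(sigma \x sigma)%E]_p (sphere_dot p ^+ n) =
  \sum_(alpha : {ffun 'I_n -> 'I_d.+1}) (moment mu alpha - moment sigma alpha) ^+ 2.
Proof.
have := sphere_dotX_cross mu n; rewrite !integral_sphere_dotX => cross.
rewrite [RHS](eq_bigr (fun alpha => moment mu alpha * moment mu alpha
    - moment sigma alpha * moment sigma alpha
    - 2 * (moment sigma alpha * moment mu alpha
           - moment sigma alpha * moment sigma alpha))); last first.
  move=> alpha _; move: (moment mu alpha) (moment sigma alpha) => A B.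
  by ring.
by rewrite sumrB -mulr_sumr !sumrB cross subrr mulr0 subr0.
Qed.

End moments.

(** * Energies of power series kernels *)

Section energy_gap.
Variables (R : realType) (d : nat).
Local Notation S := (borel_sphere R d).
Local Notation sigma := (@sigma_sphere R d).
Local Notation D := (@sphere_dot R d).
Implicit Types (mu : probability S R) (f h : R -> R) (H : R -> \bar R) (r : R).

Let norm_rD r p : 0 <= r < 1 -> `|r * D p| <= r.
Proof.
move=> /andP[r0 r1]; rewrite normrM (ger0_norm r0).
by rewrite ler_piMr// norm_sphere_dot.
Qed.

Let norm_rD_lt1 r p : 0 <= r < 1 -> `|r * D p| < 1.
Proof. by move=> r01; rewrite (le_lt_trans (norm_rD _ r01))//; have /andP[] := r01. Qed.

Lemma measurable_absmon_dot f r : absmon f -> 0 <= r < 1 ->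
  measurable_fun setT (fun p => f (r * D p)).
Proof.
move=> + r01; elim=> {f} [c n c0|f1 f2 _ a1 _ a2|f_ f af_ a_ f_f].
- apply: measurable_funM => //; apply: measurable_funX.
  by apply: measurable_funM => //; exact: measurable_sphere_dot.
- exact: measurable_funD.
- apply: (@measurable_fun_cvg _ _ _ _ (fun k p => f_ k (r * D p))) => // p _.
  exact/f_f/norm_rD_lt1.
Qed.

Lemma integrable_absmon_dot mu f r : absmon f -> 0 <= r < 1 ->
  (mu \x mu)%E.-integrable setT (EFin \o (fun p => f (r * D p))).
Proof.
move=> af r01; apply: (@bounded_integrable _ _ _ _ _ measurableT
  (product_probability_lty mu mu) _ (f r)).
  exact: measurable_absmon_dot.
by move=> p _; apply: absmon_norm_le => //; [exact: norm_rD|have /andP[] := r01].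
Qed.

Definition moment_excess mu n : R :=
  \int[(mu \x mu)%E]_p (D p ^+ n) - \int[(sigma \x sigma)%E]_p (D p ^+ n).

Lemma integral_monomial_dot mu (c r : R) n : 0 <= r < 1 ->
  \int[(mu \x mu)%E]_p (c * (r * D p) ^+ n) = c * r ^+ n * \int[(mu \x mu)%E]_p (D p ^+ n).
Proof.
move=> r01; rewrite -RintegralZl//.
  by apply: eq_Rintegral => p _; rewrite exprMn mulrA.
apply: (@bounded_integrable _ _ _ _ _ measurableT (product_probability_lty mu mu) _ 1).
  by apply: measurable_funX; exact: measurable_sphere_dot.
by move=> p _; rewrite normrX exprn_ile1// norm_sphere_dot.
Qed.

Lemma moment_excess_ge0 mu n : 0 <= moment_excess mu n.
Proof. by rewrite /moment_excess moment_gap sumr_ge0// => *; exact: sqr_ge0. Qed.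

(** The inequality holds for the powers of the inner product by [moment_gap],
    and it survives sums and bounded limits. *)
Lemma absmon_energy_le mu f r : absmon f -> 0 <= r < 1 ->
  \int[(sigma \x sigma)%E]_p f (r * D p) <= \int[(mu \x mu)%E]_p f (r * D p).
Proof.
move=> + r01; have /andP[r0 r1] := r01.
elim=> {f} [c n c0|f1 f2 af1 a1 af2 a2|f_ f af_ a_ f_f].
- rewrite !integral_monomial_dot// ler_wpM2l//.
    by rewrite mulr_ge0// exprn_ge0.
  by rewrite -subr_ge0; exact: moment_excess_ge0.
- rewrite !RintegralD//; try exact: integrable_absmon_dot.
  exact: lerD.
- have s1 : `|r| < 1 by rewrite ger0_norm.
  have [M [_ fM]] := cvg_seq_bounded (cvgP _ (f_f _ s1)).
  have M1 : M < M + 1 by rewrite ltrDl.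
  have cv (nu : probability S R) : \int[(nu \x nu)%E]_p f_ k (r * D p) @[k --> \oo] -->
      \int[(nu \x nu)%E]_p f (r * D p).
    apply: (@bounded_cvg_Rintegral _ _ _ _ _ measurableT
      (product_probability_lty nu nu) _ _ (M + 1)).
    + by move=> k; exact: measurable_absmon_dot.
    + move=> k p _; apply: le_trans (fM _ M1 k I).
      rewrite (le_trans _ (ler_norm _))//.
      exact: absmon_norm_le (norm_rD p r01) r1.
    + by move=> p _; apply: f_f; exact: norm_rD_lt1.
  rewrite -(cvg_lim _ (cv sigma))// -(cvg_lim _ (cv mu))//.
  by apply: ler_lim; [exact: cvgP (cv sigma)|exact: cvgP (cv mu)|exact: nearW].
Qed.

(** The previous inequality for h minus a monomial of degree n: positive
    coefficients make the energy control every moment. *)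
Lemma strict_absmon_energy_gap h n : strict_absmon h ->
  exists2 c, 0 < c & forall mu r, 0 <= r < 1 ->
    \int[(sigma \x sigma)%E]_p h (r * D p) + c * r ^+ n * moment_excess mu n <=
    \int[(mu \x mu)%E]_p h (r * D p).
Proof.
move=> sh; have [c c0 ch] := sh n; exists c => // mu r r01.
have := absmon_energy_le mu ch r01.
have intB (nu : probability S R) : \int[(nu \x nu)%E]_p (h (r * D p) - c * (r * D p) ^+ n) =
    \int[(nu \x nu)%E]_p h (r * D p) - c * r ^+ n * \int[(nu \x nu)%E]_p (D p ^+ n).
  rewrite RintegralB//.
  - by rewrite integral_monomial_dot.
  - exact: integrable_absmon_dot (strict_absmonW sh) r01.
  - exact: integrable_absmon_dot (absmon_monom n (ltW c0)) r01.
rewrite !intB /moment_excess mulrBr; lra.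
Qed.

Section admissible_energy.
Variables (h : R -> R) (H : R -> \bar R).
Hypothesis hH : admissible h H.

Let radius01 k : 0 <= radius R k < 1.
Proof. by rewrite radius_lt1 ltW// radius_gt0. Qed.

Lemma measurable_admissible : measurable_fun setT (fun p => H (D p)).
Proof.
apply: (@emeasurable_fun_cvg _ _ _ _ (fun k p => (h (radius R k * D p))%:E)).
  move=> k; apply/measurable_EFinP; apply: measurable_absmon_dot => //.
  exact/strict_absmonW/(admissible_absmon hH).
by move=> p _; apply: (admissible_cvg hH); exact: norm_sphere_dot.
Qed.

Let H_ge0 p : (0 <= H (D p))%E.
Proof. exact/(admissible_ge0 hH)/norm_sphere_dot. Qed.

(** For an inner product t >= 0 one has r t <= t, and for t < 0 one has
    r t <= 0; H is monotone. *)
Lemma admissible_dominated k p :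
  (`|(h (radius R k * D p))%:E| <= H (D p) + (h 0)%:E)%E.
Proof.
have rD1 := norm_rD_lt1 p (radius01 k).
have D1 := norm_sphere_dot p.
have H0E : H 0 = (h 0)%:E by rewrite (admissibleE hH)// normr0.
have H0 : (0 <= H 0)%E by apply: (admissible_ge0 hH); rewrite normr0.
rewrite -(admissibleE hH)// gee0_abs; last exact/(admissible_ge0 hH)/ltW.
rewrite -H0E; have [D0|D0] := leP 0 (D p).
  apply: (@le_trans _ _ (H (D p))); last by rewrite leeDl.
  apply: (admissible_le hH) => //; first exact: ltW.
  by rewrite ler_piMl// ltW// radius_lt1.
apply: (@le_trans _ _ (H 0)); last by rewrite leeDr.
apply: (admissible_le hH); rewrite ?normr0//; first exact: ltW.
by rewrite pmulr_rle0 ?radius_gt0// ltW.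
Qed.

Lemma admissible_energy_cvg mu :
  (\int[mu \x mu]_p H (D p) < +oo)%E ->
  (\int[(mu \x mu)%E]_p h (radius R k * D p))%:E @[k --> \oo] -->
  (\int[mu \x mu]_p H (D p))%E.
Proof.
move=> Hoo; have ah := strict_absmonW (admissible_absmon hH).
have iH : (mu \x mu)%E.-integrable setT (fun p => H (D p)).
  apply/integrableP; split; first exact: measurable_admissible.
  by under eq_integral do rewrite gee0_abs//.
have [] := @dominated_convergence _ _ R (mu \x mu)%E setT measurableT
  (fun k p => (h (radius R k * D p))%:E) (fun p => H (D p))
  (fun p => H (D p) + (h 0)%:E)%E _ _ _ _ _.
- by move=> k; apply/measurable_EFinP; exact: measurable_absmon_dot.
- exact: measurable_admissible.
- by apply: aeW => p _; apply: (admissible_cvg hH); exact: norm_sphere_dot.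
- apply: integrableD => //.
  apply: (@bounded_integrable _ _ _ _ _ measurableT
    (product_probability_lty mu mu) (cst (h 0)) `|h 0|) => //.
- by apply: aeW => p k _; exact: admissible_dominated.
move=> _ _; apply: cvg_trans; apply: near_eq_cvg; apply: nearW => k /=.
rewrite /Rintegral fineK//.
by apply: (integrable_fin_num measurableT); exact: integrable_absmon_dot.
Qed.

Lemma admissible_energy_gap n : exists2 c, 0 < c & forall mu,
  (\int[sigma \x sigma]_p H (D p) < +oo)%E ->
  (\int[mu \x mu]_p H (D p) < +oo)%E ->
  (\int[sigma \x sigma]_p H (D p) + (c * moment_excess mu n)%:E <=
   \int[mu \x mu]_p H (D p))%E.
Proof.
have [c c0 gap] := strict_absmon_energy_gap n (admissible_absmon hH).
exists c => // mu Hs Hm.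
have cs := admissible_energy_cvg Hs; have cm := admissible_energy_cvg Hm.
have cc : (\int[(sigma \x sigma)%E]_p h (radius R k * D p) +
    c * radius R k ^+ n * moment_excess mu n)%:E @[k --> \oo] -->
    (\int[sigma \x sigma]_p H (D p) + (c * moment_excess mu n)%:E)%E.
  under eq_cvg do rewrite EFinD.
  apply: cvgeD; [by rewrite fin_num_adde_defl|exact: cs|].
  apply: cvg_EFin; first exact: nearW.
  apply: cvgM; last exact: cvg_cst.
  rewrite -[X in _ --> X]mulr1 -(expr1n _ n).
  apply: cvgM; first exact: cvg_cst.
  have cX : {for (1:R), continuous (@GRing.exp R ^~ n)} by exact: exprn_continuous.
  exact: (@cvg_comp _ _ _ (radius R) (@GRing.exp R ^~ n) _ _ _ (@cvg_radius R) cX).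
rewrite -(cvg_lim _ cc)// -(cvg_lim _ cm)//.
apply: lee_lim; [exact: cvgP cc|exact: cvgP cm|apply: nearW => k].
by rewrite lee_fin gap.
Qed.

End admissible_energy.

End energy_gap.

(** * Moments determine a measure on the sphere *)

Section sign_iteration.
Variable R : realType.
Implicit Types (s : R) (k : nat).

(** A polynomial whose iterates converge to the sign function on [-1, 1]. *)
Definition sign_step s : R := s * (3 - s ^+ 2) / 2.

Lemma sign_stepN s : sign_step (- s) = - sign_step s.
Proof. by rewrite /sign_step sqrrN !mulNr. Qed.

Lemma sign_iterN s k : iter k sign_step (- s) = - iter k sign_step s.
Proof. by elim: k => //= k ->; rewrite sign_stepN. Qed.

(** 1 - t (3 - t^2) / 2 = (1 - t) (1 - t) (2 + t) / 2, and the factor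
    (1 - t) (2 + t) / 2 is at most 1 - t / 2, hence at most 1 - s / 2 as the
    iterates stay above s. *)
Lemma sign_iter_bounds s k : 0 <= s <= 1 ->
  s <= iter k sign_step s <= 1 /\ 1 - iter k sign_step s <= (1 - s / 2) ^+ k.
Proof.
move=> /andP[s0 s1]; elim: k => [|k [/andP[h1 h2] h3]] /=.
  by rewrite lexx s1 expr0 lerBlDr lerDl.
move: h1 h2 h3; move: (iter k sign_step s) => t st t1 ht.
rewrite /sign_step.
have t0 : 0 <= t := le_trans s0 st.
have t2 : t ^+ 2 <= 1 by rewrite expr_le1.
have e : 1 - t * (3 - t ^+ 2) / 2 = (1 - t) * ((1 - t) * (2 + t) / 2) by field.
have ge0 : 0 <= (1 - t) * ((1 - t) * (2 + t) / 2).
  by rewrite !mulr_ge0//; lra.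
split; first by apply/andP; split; [nra|lra].
rewrite e exprS mulrC; apply: ler_pM => //; [|lra|].
  by rewrite !mulr_ge0//; lra.
nra.
Qed.

Lemma norm_sign_iter s k : `|s| <= 1 -> `|iter k sign_step s| <= 1.
Proof.
move=> s1; have s01 : 0 <= `|s| <= 1 by rewrite normr_ge0.
have [/andP[a b] _] := sign_iter_bounds k s01.
have -> : `|iter k sign_step s| = `|iter k sign_step `|s| |.
  by have [_|_] := ler0P s; rewrite ?sign_iterN ?normrN.
by rewrite ger0_norm// (le_trans _ a).
Qed.

Lemma cvg_sign_iter s : `|s| <= 1 -> iter k sign_step s @[k --> \oo] --> Num.sg s.
Proof.
have pos t : 0 < t <= 1 -> iter k sign_step t @[k --> \oo] --> (1 : R).
  move=> /andP[t0 t1]; have t01 : 0 <= t <= 1 by rewrite ltW.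
  apply/cvgrPdist_le => e e0.
  have q : `|1 - t / 2| < 1 by rewrite ltr_norml; apply/andP; split; lra.
  have /cvgrPdist_le/(_ _ e0) := cvg_expr q.
  apply: filterS => k /=; rewrite sub0r normrN.
  have [/andP[a b] c] := sign_iter_bounds k t01.
  move=> h; rewrite ger0_norm ?subr_ge0//.
  exact: le_trans c (le_trans (ler_norm _) h).
move=> s1; have [s0|s0|->] := ltrgt0P s.
- by rewrite gtr0_sg//; apply: pos; rewrite s0 -(gtr0_norm s0).
- rewrite ltr0_sg//.
  have : - iter k sign_step (- s) @[k --> \oo] --> (- 1 : R).
    by apply: cvgN; apply: pos; rewrite oppr_gt0 s0 -(ltr0_norm s0).
  apply: cvg_trans; apply: near_eq_cvg; apply: nearW => k.
  by rewrite sign_iterN opprK.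
- rewrite sgr0 (_ : (fun k => _) = cst 0); first exact: cvg_cst.
  by apply/funext => k; elim: k => //= k ->; rewrite /sign_step !mul0r.
Qed.

End sign_iteration.

Section determination_by_moments.
Variables (R : realType) (d : nat).
Local Notation S := (borel_sphere R d).
Implicit Types (f g : S -> R) (A : set S).

Definition coord_product (s : seq 'I_d.+1) (x : S) : R :=
  \prod_(i <- s) sphere_val x ord0 i.

(** The closure of the polynomials under bounded pointwise limits: two measures
    with the same moments give the same integral to these functions.  The class
    contains the indicators of all Borel sets. *)
Inductive moment_determined : (S -> R) -> Prop :=
| mdet_monom c s : moment_determined (fun x => c * coord_product s x)
| mdetD f g : moment_determined f -> moment_determined g ->
    moment_determined (fun x => f x + g x)
| mdet_lim (f_ : nat -> S -> R) f C : (forall k, moment_determined (f_ k)) ->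
    (forall k x, `|f_ k x| <= C) ->
    (forall x, f_ k x @[k --> \oo] --> f x) -> moment_determined f.

Lemma eq_mdet f g : f =1 g -> moment_determined f -> moment_determined g.
Proof. by move=> /funext ->. Qed.

Lemma mdet_bounded f : moment_determined f ->
  measurable_fun setT f /\ exists C, forall x, `|f x| <= C.
Proof.
elim=> {f} [c s|f g _ [mf [C fC]] _ [mg [E gE]]|f_ f C _ a_ f_C f_f].
- split.
    apply: measurable_funM => //; apply: measurable_prod => i _.
    exact: measurable_sphere_coord.
  exists `|c| => x; rewrite normrM ler_piMr// normr_prod.
  by apply: prodr_ile1 => i _; rewrite normr_ge0 norm_sphere_coord.
- split; first exact: measurable_funD.
  by exists (C + E) => x; rewrite (le_trans (ler_normD _ _))// lerD.
- split.
    apply: (@measurable_fun_cvg _ _ _ _ f_) => [k|x _]; last exact: f_f.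
    by have [] := a_ k.
  exists C => x; have ft : `|f_ k x| @[k --> \oo] --> `|f x|.
    by apply: cvg_norm; exact: f_f.
  rewrite -(cvg_lim _ ft)//; apply: limr_le; first exact: cvgP ft.
  exact: nearW.
Qed.

Lemma mdet_cst c : moment_determined (fun=> c).
Proof.
apply: eq_mdet (mdet_monom c [::]) => x.
by rewrite /coord_product big_nil mulr1.
Qed.

Lemma mdetM f g : moment_determined f -> moment_determined g ->
  moment_determined (fun x => f x * g x).
Proof.
move=> mf mg; elim: mf => {f} [c s|f1 f2 _ a1 _ a2|f_ f C af_ a_ f_C f_f].
- elim: mg => {g} [e t|g1 g2 _ a1 _ a2|g_ g C ag_ a_ g_C g_g].
  + apply: eq_mdet (mdet_monom (c * e) (s ++ t)) => x.
    by rewrite /coord_product big_cat/=; ring.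
  + by apply: eq_mdet (mdetD a1 a2) => x; rewrite mulrDr.
  + have [_ [E E0]] := mdet_bounded (mdet_monom c s).
    apply: (mdet_lim (C := E * C) a_) => [k x|x].
      by rewrite normrM ler_pM// ?E0// g_C.
    by apply: cvgM; [exact: cvg_cst|exact: g_g].
- by apply: eq_mdet (mdetD a1 a2) => x; rewrite mulrDl.
- have [_ [E E0]] := mdet_bounded mg.
  apply: (mdet_lim (C := C * E) a_) => [k x|x].
    by rewrite normrM ler_pM// ?E0// f_C.
  by apply: cvgM; [exact: f_f|exact: cvg_cst].
Qed.

Lemma mdetZ c f : moment_determined f -> moment_determined (fun x => c * f x).
Proof. exact: mdetM (mdet_cst c). Qed.

Lemma mdetB f g : moment_determined f -> moment_determined g ->
  moment_determined (fun x => f x - g x).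
Proof.
move=> mf mg; apply: eq_mdet (mdetD mf (mdetZ (-1) mg)) => x.
by rewrite mulN1r.
Qed.

Lemma mdet_sign_iter k f : moment_determined f ->
  moment_determined (fun x => iter k (@sign_step R) (f x)).
Proof.
move=> mf; elim: k => [//|k ih].
apply: eq_mdet (mdetZ 2^-1 (mdetM ih (mdetB (mdet_cst 3) (mdetM ih ih)))) => x.
by rewrite /= /sign_step; field.
Qed.

(** The indicator of the positive numbers is (sg + sg^2) / 2, and the sign is a
    limit of polynomials. *)
Lemma mdet_halfspace (i : 'I_d.+1) (a : R) :
  moment_determined (\1_[set x : S | a < sphere_val x ord0 i]).
Proof.
pose c := 1 + `|a|; have c0 : 0 < c by rewrite ltr_pwDl.
pose u (x : S) := c^-1 * (sphere_val x ord0 i - a).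
have mu : moment_determined u.
  apply: mdetZ; apply: mdetB; last exact: mdet_cst.
  apply: eq_mdet (mdet_monom 1 [:: i]) => x.
  by rewrite /coord_product big_seq1 mul1r.
have u1 x : `|u x| <= 1.
  rewrite /u normrM gtr0_norm ?invr_gt0// ler_pdivrMl// mulr1.
  rewrite (le_trans (ler_normB _ _))// lerD2r.
  exact: norm_sphere_coord.
have ms : moment_determined (fun x => Num.sg (u x)).
  apply: (mdet_lim (f_ := fun k x => iter k (@sign_step R) (u x)) (C := 1)).
  - by move=> k; exact: mdet_sign_iter.
  - by move=> k x; exact: norm_sign_iter.
  - by move=> x; exact: cvg_sign_iter.
apply: eq_mdet (mdetZ 2^-1 (mdetD ms (mdetM ms ms))) => x.
rewrite indicE; have [ax|xa] := ltP a (sphere_val x ord0 i).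
  rewrite mem_set// gtr0_sg; last by rewrite mulr_gt0 ?invr_gt0// subr_gt0.
  by rewrite mul1r /=; field.
rewrite memNset/=; last by apply/negP; rewrite -leNgt.
move: xa; rewrite le_eqVlt => /predU1P[xE|xa].
  by rewrite /u xE subrr mulr0 sgr0; ring.
rewrite ltr0_sg; first by ring.
by rewrite pmulr_rlt0 ?invr_gt0// subr_lt0.
Qed.

(** The class is an algebra closed under bounded limits, and the indicator of a
    countable union is 1 minus the limit of the products of the indicators of the
    complements. *)
Lemma mdet_sigma_algebra :
  sigma_algebra setT [set A | moment_determined (\1_A)].
Proof.
split=> [|A mA|F mF] /=.
- by apply: eq_mdet (mdet_cst 0) => x; rewrite indic0.
- apply: eq_mdet (mdetB (mdet_cst 1) mA) => x.
  by rewrite setTD !indicE in_setC; case: (x \in A) => /=; ring.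
- have mP k : moment_determined (fun x => \prod_(j < k) (1 - \1_(F j) x)).
    elim: k => [|k ih]; first by apply: eq_mdet (mdet_cst 1) => x; rewrite big_ord0.
    apply: eq_mdet (mdetM ih (mdetB (mdet_cst 1) (mF k))) => x.
    by rewrite big_ord_recr.
  have P01 k x : 0 <= \prod_(j < k) (1 - \1_(F j) x : R) <= 1.
    have h j : 0 <= (1 - \1_(F j) x : R) <= 1.
      by rewrite indicE; case: (x \in F j) => /=; apply/andP; split; lra.
    by rewrite prodr_ge0 => [|j _]; [rewrite prodr_ile1|have /andP[] := h j].
  apply: (mdet_lim (f_ := fun k x => 1 - \prod_(j < k) (1 - \1_(F j) x)) (C := 1)).
  + by move=> k; apply: mdetB; first exact: mdet_cst.
  + move=> k x; have /andP[a b] := P01 k x.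
    by rewrite ler_norml; apply/andP; split; lra.
  + move=> x; have [[j _ Fjx]|nF] := pselect ((\bigcup_k F k) x).
      rewrite [X in _ --> X]indicE mem_set; last by exists j.
      apply: cvg_near_cst; near=> k.
      have jk : (j < k)%N by near: k; exact: nbhs_infty_gt.
      rewrite (bigD1 (Ordinal jk))//= indicE mem_set// subrr mul0r subr0//.
    rewrite [X in _ --> X]indicE memNset//.
    apply: cvg_near_cst; apply: nearW => k.
    rewrite big1 ?subrr// => j _; rewrite indicE memNset ?subr0//.
    by move=> Fjx; apply: nF; exists (j : nat).
Unshelve. all: by end_near. Qed.

Lemma mdet_measurable A : measurable A -> moment_determined (\1_A).
Proof.
pose G : set (set S) := [set B | exists i a, B = [set x : S | a < sphere_val x ord0 i]].
have GM : <<s G >> `<=` [set B | moment_determined (\1_B)].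
  apply: smallest_sub; first exact: mdet_sigma_algebra.
  by move=> _ [i [a ->]]; exact: mdet_halfspace.
have mval : measurable_fun setT (@sphere_val R d : g_sigma_algebraType G -> borel_rV R d.+1).
  apply: measurable_rV => i.
  apply: (measurability _ (RGenOInfty.measurableE R)) => _ [_ [a ->] <-].
  rewrite setTI; apply: sub_sigma_algebra; exists i, a.
  by apply/seteqP; split=> x /=; rewrite in_itv/= andbT.
suff h : <<s @open (sphere R d) >> `<=` [set B | moment_determined (\1_B)].
  exact: h.
apply: smallest_sub; first exact: mdet_sigma_algebra.
move=> _ [W oW <-]; apply: GM.
rewrite -[X in <<s G >> X]setTI; apply: mval => //.
exact: sub_sigma_algebra.
Qed.

Lemma same_measure_of_moments (P Q : probability S R) :
  (forall n (alpha : {ffun 'I_n -> 'I_d.+1}), moment P alpha = moment Q alpha) ->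
  same_measure P Q.
Proof.
move=> PQ A mA.
have PT (P' : probability S R) : (P' setT < +oo)%E by rewrite probability_setT ltry.
have intE f : moment_determined f -> \int[P]_x f x = \int[Q]_x f x.
  have ib (P' : probability S R) g : moment_determined g -> P'.-integrable setT (EFin \o g).
    move=> /mdet_bounded[mg [C gC]].
    exact: (@bounded_integrable _ _ _ _ _ measurableT (PT P') _ C).
  elim=> {f} [c s|f g af a1 ag a2|f_ f C af_ a_ f_C f_f].
  - have i1 (P' : probability S R) : P'.-integrable setT (EFin \o coord_product s).
      apply: ib; apply: eq_mdet (mdet_monom 1 s) => x; exact: mul1r.
    have iZ (P' : probability S R) : \int[P']_x (c * coord_product s x) =
        c * \int[P']_x coord_product s x.
      by rewrite RintegralZl//; exact: i1.
    rewrite !iZ; congr (_ * _).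
    have -> : coord_product s =
        sphere_monomial [ffun i : 'I_(size s) => nth ord0 s i].
      apply/funext => x; rewrite /sphere_monomial /coord_product.
      under [RHS]eq_bigr do rewrite ffunE.
      rewrite -(big_mkord xpredT (fun i => sphere_val x ord0 (nth ord0 s i))).
      exact: (big_nth ord0).
    exact: PQ.
  - by rewrite !RintegralD ?a1 ?a2//; exact: ib.
  - have cv (P' : probability S R) : \int[P']_x f_ k x @[k --> \oo] --> \int[P']_x f x.
      apply: (@bounded_cvg_Rintegral _ _ _ _ _ measurableT (PT P') _ _ C) => //.
      by move=> k; have [] := mdet_bounded (af_ k).
    rewrite -(cvg_lim _ (cv P))// -(cvg_lim _ (cv Q))//.
    by congr (lim (_ @ \oo)); apply/funext.
have := intE _ (mdet_measurable mA).
rewrite /Rintegral !integral_indic// !setIT => PA.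
by rewrite -[LHS]fineK ?fin_num_measure// -[RHS]fineK ?fin_num_measure// PA.
Qed.

End determination_by_moments.

(** * Measure of spherical caps *)

Section caps.
Variables (R : realType) (d : nat).
Local Notation S := (borel_sphere R d).
Local Notation sigma := (@sigma_sphere R d).
Implicit Types (rho : R) (x : S).

(** A neighborhood of the two poles on the first axis that contains the cap of
    geodesic radius rho, as sin t <= t; the cone over it fits in a box whose d
    thin sides have length 2 rho. *)
Definition double_cap rho : set S :=
  [set x | forall i : 'I_d, `|sphere_val x ord0 (lift ord0 i)| <= rho].

Lemma measurable_double_cap rho : measurable (double_cap rho).
Proof.
have -> : double_cap rho = \bigcap_(i in [set: 'I_d])
    ((fun x : S => `|sphere_val x ord0 (lift ord0 i)|) @^-1` `]-oo, rho]).
  apply/seteqP; split=> x /= h i; first by move=> _ /=; rewrite in_itv/=.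
  by have := h i I; rewrite /= in_itv.
apply: fin_bigcap_measurable => // i _.
rewrite -[X in measurable X]setTI.
have mc : measurable_fun setT (fun x : S => `|sphere_val x ord0 (lift ord0 i)|).
  by apply: measurableT_comp => //; exact: measurable_sphere_coord.
by apply: mc => //; exact: measurable_itv.
Qed.

Lemma lebesgue_cone_double_cap rho : 0 <= rho ->
  (lebesgue_rV R d.+1 (cone (double_cap rho)) <= ((rho *+ 2) ^+ d * 2)%:E)%E.
Proof.
move=> rho0.
pose Q : set (borel_rV R d.+1) := [set v |
  (forall i : 'I_d, `|(v : 'rV[R]_d.+1) ord0 (lift ord0 i)| <= rho)
  /\ `|(v : 'rV[R]_d.+1) ord0 ord0| <= 1].
have mQ : measurable Q.
  have mc i : measurable_fun setT (fun v : borel_rV R d.+1 => `|(v : 'rV[R]_d.+1) ord0 i|).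
    by apply: measurableT_comp => //; exact: measurable_coord.
  have -> : Q = (\bigcap_(i in [set: 'I_d])
      ((fun v : borel_rV R d.+1 => `|(v : 'rV[R]_d.+1) ord0 (lift ord0 i)|) @^-1` `]-oo, rho]))
      `&` ((fun v : borel_rV R d.+1 => `|(v : 'rV[R]_d.+1) ord0 ord0|) @^-1` `]-oo, 1]).
    apply/seteqP; split=> v.
      move=> [h h0]; split; first by move=> i _; rewrite /= in_itv/=; exact: h.
      by rewrite /= in_itv.
    move=> [h h0]; split.
      by move=> i; have := h i I; rewrite /= in_itv.
    by move: h0; rewrite /= in_itv.
  apply: measurableI.
    apply: fin_bigcap_measurable => // i _; rewrite -[X in measurable X]setTI.
    by apply: mc => //; exact: measurable_itv.
  by rewrite -[X in measurable X]setTI; apply: mc => //; exact: measurable_itv.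
apply: (@le_trans _ _ (lebesgue_rV R d.+1 Q)).
  apply: le_measure; rewrite ?inE//.
    by apply: measurable_cone; exact: measurable_double_cap.
  move=> v [x [r [Px /andP[r0 r1] ->]]]; split=> [i|]; rewrite mxE normrM gtr0_norm//.
    by rewrite (le_trans _ (Px i))// ler_piMl.
  by apply: mulr_ile1 => //; [exact: ltW|exact: norm_sphere_coord].
rewrite /= /lebesgue_rV_step /pushforward.
rewrite (_ : _ @^-1` _ = ([set v | forall i, - rho <= (v : 'rV[R]_d) ord0 i <= rho]
    : set (borel_rV R d)) `*` (`[-1, 1]%classic : set (measurableTypeR R))); last first.
  apply/seteqP; split => -[v t] /= [h h0].
    split=> [i|]; first by have := h i; rewrite rV_consS ler_norml.
    by move: h0; rewrite rV_cons0 ler_norml in_itv.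
  split=> [i|]; first by have := h i; rewrite rV_consS ler_norml.
  by move: h0; rewrite rV_cons0 ler_norml in_itv.
rewrite product_measure1E//; last exact: measurable_rV_box.
rewrite lebesgue_rV_box; last by lra.
rewrite [X in (_ * X)%E](_ : _ = 2%:E).
  by rewrite opprK -mulr2n -EFinM lexx.
apply: etrans (@lebesgue_measure_itv R `[-1, 1]) _.
have N11 : -1 < 1 :> R by lra.
by rewrite /= lte_fin N11 -EFinB; congr EFin; lra.
Qed.

Lemma sigma_double_cap : exists2 C : R, 0 <= C &
  forall rho, 0 <= rho -> (sigma (double_cap rho) <= (C * rho ^+ d)%:E)%E.
Proof.
pose c : R := (fine (surface_measure [set: S]))^-1.
have c0 : 0 <= c by rewrite invr_ge0 fine_ge0.
exists (c * (d.+1%:R * (2 ^+ d * 2))).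
  by rewrite !mulr_ge0// exprn_ge0.
move=> rho rho0; rewrite /sigma_sphere /surface_measure -/c.
have -> : c * (d.+1%:R * (2 ^+ d * 2)) * rho ^+ d = c * (d.+1%:R * ((rho *+ 2) ^+ d * 2)).
  by rewrite -[rho *+ 2]mulr_natr exprMn; ring.
rewrite (EFinM c) (EFinM d.+1%:R).
apply: lee_wpmul2l; first by rewrite lee_fin.
apply: lee_wpmul2l; first by rewrite lee_fin.
exact: lebesgue_cone_double_cap.
Qed.

Lemma sin_le_id (t : R) : 0 <= t -> sin t <= t.
Proof.
rewrite le_eqVlt => /predU1P[<-|t0]; first by rewrite sin0.
have ds (y : R) : y \in `]0, t[ -> is_derive y 1 (@sin R) (cos y) by move=> _; exact: is_derive_sin.
have cs : {within `[0, t], continuous (@sin R)}.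
  by apply: continuous_subspaceT => y; exact: continuous_sin.
have [c _] := MVT t0 ds cs; rewrite sin0 !subr0 => ->.
by rewrite ler_piMl ?cos_le1// ltW.
Qed.

Lemma acos_double_cap x rho : acos (sphere_val x ord0 ord0) <= rho -> double_cap rho x.
Proof.
move=> h i; apply: le_trans h.
have x1 := norm_sphere_coord x ord0; have /andP[a0 _] := acos_bounds x1.
apply: le_trans (sin_le_id a0); rewrite sin_acos -?ler_norml//.
rewrite -sqrtr_sqr ler_sqrt; last first.
  rewrite subr_ge0 -[leRHS](expr1n _ 2) -real_normK ?num_real//.
  by rewrite lerXn2r// nnegrE.
rewrite lerBrDl -(dotrv_sphere x) /dotrv (bigD1 ord0)//= (bigD1 (lift ord0 i))//=.
rewrite !expr2 addrA lerDl.
by apply: sumr_ge0 => j _; exact: sqr_ge0.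
Qed.

End caps.

(** * Finiteness of the energy of the surface measure *)

Section finite_energy.
Variables (R : realType) (d : nat).
Local Notation S := (borel_sphere R d).
Local Notation sigma := (@sigma_sphere R d).
Local Notation D := (@sphere_dot R d).
Implicit Types (x y : S) (delta t : R).

Lemma sphere_dot_point x : D (x, point) = sphere_val x ord0 ord0.
Proof.
rewrite /sphere_dot /dotrv /= (bigD1 ord0)//= big1 ?addr0.
  by rewrite [X in _ * X]mxE !eqxx mulr1.
by move=> i /negbTE i0; rewrite [X in _ * X]mxE i0 andbF mulr0.
Qed.

(** The caps have geodesic radii pi / 2^k, and the k-th weight is the value of
    the kernel at distance pi / 2^(k+1). *)
Let cap k : set S := double_cap (pi / 2 ^+ k).
Let weight delta k : R := pi `^ delta * (2 `^ (- delta)) ^+ k.+1.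

Let weight_ge0 delta k : 0 <= weight delta k.
Proof. by rewrite mulr_ge0 ?exprn_ge0 ?powR_ge0. Qed.

Let weightE delta k : weight delta k = (pi / 2 ^+ k.+1) `^ delta.
Proof.
rewrite /weight powRM ?pi_ge0 ?invr_ge0 ?exprn_ge0//; congr (_ * _).
have e0 : 0 < 2 ^+ k.+1 :> R by rewrite exprn_gt0.
rewrite /powR !gt_eqF ?invr_gt0// lnV ?posrE// lnXn// -expRM_natl.
by congr expR; rewrite -mulr_natl; ring.
Qed.

Let dyadic_scale (s : R) : 0 < s <= pi ->
  exists k, pi / 2 ^+ k.+1 < s <= pi / 2 ^+ k.
Proof.
move=> /andP[s0 sp].
have ex : exists n, pi / 2 ^+ n < s.
  exists (Num.bound (pi / s)); rewrite ltr_pdivrMr ?exprn_gt0//.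
  rewrite mulrC -ltr_pdivrMr//.
  apply: (lt_le_trans (archi_boundP _)); first by rewrite divr_ge0 ?pi_ge0 ?ltW.
  by rewrite -natrX ler_nat ltnW// ltn_expl.
have [[|k] kP kmin] := ex_minnP ex.
  by move: kP; rewrite expr0 divr1 ltNge sp.
exists k; rewrite kP/= leNgt; apply/negP => /kmin.
by rewrite ltnn.
Qed.

(** On the shell pi / 2^(k+1) < acos t <= pi / 2^k the kernel is at most the
    k-th term.  At the pole all indicators are 1 and the series diverges, in
    accordance with the infinite value of the kernel. *)
Let dyadic_bound delta x : delta < 0 ->
  (geodesic_kernel delta (D (x, point)) <=
   \sum_(k <oo) (weight delta k * \1_(cap k) x)%:E)%E.
Proof.
move=> dlt0; rewrite sphere_dot_point; set t := sphere_val x ord0 ord0.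
have t1 : `|t| <= 1 by exact: norm_sphere_coord.
have u0 k : (0 <= (weight delta k * \1_(cap k) x)%:E)%E.
  by rewrite lee_fin mulr_ge0.
have in_cap k : acos t <= pi / 2 ^+ k -> \1_(cap k) x = 1 :> R.
  by move=> h; rewrite indicE mem_set//; exact: acos_double_cap.
have [tE|tn1] := eqVneq t 1.
  rewrite {1}/geodesic_kernel tE eqxx (ltW dlt0)/= leye_eq; apply/eqP/eq_infty => r.
  pose c : R := pi `^ delta; have c0 : 0 < c by rewrite powR_gt0 ?pi_gt0.
  apply: (@le_trans _ _ (\sum_(0 <= k < Num.bound (`|r| / c))
      (weight delta k * \1_(cap k) x)%:E)%E); last first.
    by apply: nneseries_lim_ge => k _ _; exact: u0.
  apply: (@le_trans _ _ (\sum_(0 <= k < Num.bound (`|r| / c)) c%:E)%E); last first.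
    apply: lee_sum => k _; rewrite lee_fin in_cap; last first.
      by rewrite tE acos1 divr_ge0 ?pi_ge0 ?exprn_ge0.
    rewrite mulr1 ler_pMr// exprn_ege1//.
    by rewrite -[leLHS](powRr0 (2 : R)) ler_powR ?ler1n// oppr_ge0 ltW.
  rewrite sumEFin lee_fin big_mkord sumr_const card_ord -mulr_natl.
  rewrite -ler_pdivrMr// (le_trans _ (ltW (archi_boundP _)))//.
    by rewrite ler_pM2r ?invr_gt0// ler_norm.
  by rewrite divr_ge0// ltW.
have at0 := acos_gt0_neq1 t1 tn1; have /andP[_ tp] := acos_bounds t1.
have s0p : 0 < acos t <= pi by rewrite at0.
have [k /andP[k1 k2]] := dyadic_scale s0p.
rewrite /geodesic_kernel (negbTE tn1) andbF (lt_eqF dlt0).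
apply: (@le_trans _ _ (weight delta k * \1_(cap k) x)%:E).
  rewrite in_cap// mulr1 lee_fin weightE.
  apply: powR_npos_le; rewrite ?ltW// divr_gt0 ?pi_gt0 ?exprn_gt0//.
apply: (@le_trans _ _ (\sum_(0 <= j < k.+1) (weight delta j * \1_(cap j) x)%:E)%E).
  by rewrite big_nat_recr//= leeDr// sume_ge0.
by apply: nneseries_lim_ge => j _ _; exact: u0.
Qed.

Lemma measurable_geodesic_kernel delta : delta <= 0 ->
  measurable_fun setT (fun p : S * S => geodesic_kernel delta (D p)).
Proof. by move=> /admissible_geodesic; exact: measurable_admissible. Qed.

Let measurable_potential delta y : delta <= 0 ->
  measurable_fun setT (fun x => geodesic_kernel delta (D (x, y))).
Proof.
by move=> /measurable_geodesic_kernel mK; apply: (measurableT_comp mK); exact: measurable_pair2.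
Qed.

Let kernel_ge0 delta (p : S * S) : (0 <= geodesic_kernel delta (D p))%E.
Proof. by apply: geodesic_kernel_ge0; exact: norm_sphere_dot. Qed.

(** The k-th cap has measure O(2^(- k d)), so the series of the integrals is
    dominated by a geometric series of ratio 2^(- delta - d) < 1. *)
Lemma neg_potential_lty delta : - d%:R < delta < 0 ->
  (\int[sigma]_x geodesic_kernel delta (D (x, point)) < +oo)%E.
Proof.
move=> /andP[dd d0]; have [C C0 capC] := sigma_double_cap R d.
have mcap k : measurable (cap k) by exact: measurable_double_cap.
have mg k : measurable_fun setT (fun x => (weight delta k * \1_(cap k) x)%:E).
  by apply/measurable_EFinP; apply: measurable_funM.
have g0 k x : (0 <= (weight delta k * \1_(cap k) x)%:E)%E.
  by rewrite lee_fin mulr_ge0.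
apply: (@le_lt_trans _ _
    (\int[sigma]_x \sum_(k <oo) (weight delta k * \1_(cap k) x)%:E)%E).
  apply: ge0_le_integral => //.
  - by apply: measurable_potential; exact: ltW.
  - by apply: ge0_emeasurable_sum.
  - by move=> x _; exact: dyadic_bound.
rewrite integral_nneseries//.
pose b : R := 2 `^ (- delta); pose q : R := b / 2 ^+ d.
have b0 : 0 < b by rewrite powR_gt0.
have q0 : 0 < q by rewrite divr_gt0// exprn_gt0.
have q1 : q < 1.
  rewrite ltr_pdivrMr ?exprn_gt0// mul1r -powR_mulrn// /b /powR !gt_eqF//.
  by rewrite ltr_expR ltr_pM2r ?ln_gt0// ?ltr1n//; lra.
pose K : R := pi `^ delta * b * (C * pi ^+ d).
have K0 : 0 <= K by rewrite !mulr_ge0// ?powR_ge0 ?exprn_ge0 ?pi_ge0.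
have intg k : (\int[sigma]_x (weight delta k * \1_(cap k) x)%:E <= (K * q ^+ k)%:E)%E.
  under eq_integral do rewrite EFinM.
  rewrite ge0_integralZl//; [|exact/measurable_EFinP|by rewrite lee_fin].
  rewrite integral_indic// setIT.
  have -> : K * q ^+ k = weight delta k * (C * (pi / 2 ^+ k) ^+ d).
    rewrite /K /q /weight -/b exprS !exprMn !exprVn -!exprM (mulnC d k); ring.
  rewrite [leRHS]EFinM; apply: lee_wpmul2l; first by rewrite lee_fin.
  by apply: capC; rewrite divr_ge0 ?pi_ge0 ?exprn_ge0.
apply: (@le_lt_trans _ _ (K / (1 - q))%:E); last by rewrite ltry.
apply: lime_le.
  by apply: is_cvg_nneseries => k _ _; apply: integral_ge0 => x _; exact: g0.
apply: nearW => n; apply: (@le_trans _ _ (\sum_(0 <= k < n) (K * q ^+ k)%:E)%E).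
  by apply: lee_sum => k _; exact: intg.
have qn : 1 - q != 0 by rewrite subr_eq0 eq_sym lt_eqF.
rewrite sumEFin lee_fin -mulr_sumr ler_wpM2l//.
have := geometric_seriesE 1 (negbT (lt_eqF q1)).
move=> /(congr1 (fun f => f n)); rewrite /series/=.
under eq_bigr do rewrite mul1r.
move=> ->; rewrite mul1r -[leRHS]mul1r ler_wpM2r// ?invr_ge0 ?subr_ge0 ?(ltW q1)//.
by rewrite lerBlDr lerDl exprn_ge0// ltW.
Qed.

(** ln y <= 2 sqrt y compares the logarithmic kernel with the exponent - 1/2,
    which exceeds - d as d >= 1. *)
Lemma log_kernel_le t : `|t| <= 1 ->
  (geodesic_kernel 0 t <= (2 * pi `^ 2^-1)%:E * geodesic_kernel (- 2^-1) t)%E.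
Proof.
move=> t1; have p0 := pi_gt0 R.
have c0 : 0 < 2 * pi `^ 2^-1 :> R by rewrite mulr_gt0// powR_gt0.
have hN : - 2^-1 <= 0 :> R by lra.
rewrite /geodesic_kernel lexx hN/= eqxx.
have [_|tn1] := eqVneq t 1; first by rewrite gt0_muley// ?lte_fin.
have at0 := acos_gt0_neq1 t1 tn1.
rewrite lt_eqF; last by lra.
rewrite -EFinM lee_fin.
have pa : 0 < pi / acos t :> R by rewrite divr_gt0.
have -> : 2 * pi `^ 2^-1 * acos t `^ (- 2^-1) = 2 * (pi / acos t) `^ 2^-1.
  rewrite powRM ?invr_ge0 ?ltW// mulrA; congr (_ * _).
  by rewrite -[(acos t)^-1]powR_inv1 ?ltW// -powRrM mulN1r.
have -> : ln (pi / acos t) = 2 * ln ((pi / acos t) `^ 2^-1).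
  by rewrite ln_powR mulrA divff// mul1r.
by rewrite ler_pM2l// ltW// ln_sublinear// powR_gt0.
Qed.

Lemma geodesic_potential_lty delta : (1 <= d)%N -> - d%:R < delta <= 0 ->
  (\int[sigma]_x geodesic_kernel delta (D (x, point)) < +oo)%E.
Proof.
move=> d1 /andP[dd]; rewrite le_eqVlt => /predU1P[->|d0]; last first.
  by apply: neg_potential_lty; rewrite dd.
have hN : - 2^-1 <= 0 :> R by lra.
apply: (@le_lt_trans _ _ (\int[sigma]_x ((2 * pi `^ 2^-1)%:E *
    geodesic_kernel (- 2^-1) (D (x, point))))%E).
  apply: ge0_le_integral => //.
  - exact: measurable_potential.
  - by apply: measurable_funeM; exact: measurable_potential.
  - by move=> x _; apply: log_kernel_le; exact: norm_sphere_dot.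
rewrite ge0_integralZl//; last 2 first.
- exact: measurable_potential.
- by rewrite lee_fin mulr_ge0 ?powR_ge0.
apply: lte_mul_pinfty; rewrite ?lee_fin ?mulr_ge0 ?powR_ge0//.
apply: neg_potential_lty.
have : 1 <= d%:R :> R by rewrite ler1n.
by move=> ?; apply/andP; split; lra.
Qed.

Lemma geodesic_energyE delta (mu : probability S R) : delta <= 0 ->
  geodesic_energy delta mu = (\int[mu \x mu]_p geodesic_kernel delta (D p))%E.
Proof.
by move=> d0; rewrite fubini_tonelli2//; exact: measurable_geodesic_kernel.
Qed.

Lemma geodesic_energy_sigma_lty delta : (1 <= d)%N -> - d%:R < delta <= 0 ->
  (geodesic_energy delta sigma < +oo)%E.
Proof.
move=> d1 dd; have /andP[_ d0] := dd.
have zonal (y : S) : (\int[sigma]_x geodesic_kernel delta (D (x, y)) =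
    \int[sigma]_x geodesic_kernel delta (D (x, point)))%E.
  apply: (@sigma_sphere_zonal R d (geodesic_kernel delta) y point).
    exact: measurable_potential.
  by move=> t; exact: geodesic_kernel_ge0.
rewrite /geodesic_energy.
under eq_integral do rewrite zonal.
rewrite (integral_cst sigma measurableT).
rewrite [X in (_ * X)%E](_ : _ = 1%E); last exact: probability_setT.
by rewrite mule1 geodesic_potential_lty.
Qed.

End finite_energy.

(** * Extremality of the surface measure *)

Section extremality.
Variables (R : realType) (d : nat).
Local Notation S := (borel_sphere R d).
Local Notation sigma := (@sigma_sphere R d).
Local Notation D := (@sphere_dot R d).
Implicit Types (mu : probability S R) (delta : R).

(** The excess is a sum of squares, so it vanishes only if all moments agree. *)
Lemma same_measure_of_excess mu :
  (forall n, moment_excess mu n <= 0) -> same_measure mu sigma.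
Proof.
move=> mu0; apply: same_measure_of_moments => n alpha.
have := mu0 n; rewrite /moment_excess moment_gap => le0.
have sq0 : \sum_(alpha : {ffun 'I_n -> 'I_d.+1})
    (moment mu alpha - moment sigma alpha) ^+ 2 == 0.
  by rewrite eq_le le0 sumr_ge0// => *; exact: sqr_ge0.
move: sq0; rewrite psumr_eq0; last by move=> *; exact: sqr_ge0.
move=> /allP/(_ alpha); rewrite mem_index_enum => /(_ isT) /=.
by rewrite sqrf_eq0 subr_eq0 => /eqP.
Qed.

(** Finiteness of the energy of the surface measure is what makes equality in
    [admissible_energy_gap] force every excess to vanish. *)
Lemma admissible_extremal h (H : R -> \bar R) : admissible h H ->
  (\int[sigma \x sigma]_p H (D p) < +oo)%E ->
  (forall mu, \int[sigma \x sigma]_p H (D p) <= \int[mu \x mu]_p H (D p))%E /\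
  (forall mu, (\int[mu \x mu]_p H (D p) <= \int[sigma \x sigma]_p H (D p))%E ->
    same_measure mu sigma).
Proof.
move=> hH sfin.
have s0 : (0 <= \int[sigma \x sigma]_p H (D p))%E.
  by apply: integral_ge0 => p _; apply: (admissible_ge0 hH); exact: norm_sphere_dot.
split=> mu.
  have [mfin|] := ltP (\int[mu \x mu]_p H (D p))%E +oo%E; last first.
    by rewrite leye_eq => /eqP ->; rewrite leey.
  have [c c0 gap] := admissible_energy_gap d hH 0.
  apply: le_trans (gap mu sfin mfin); rewrite leeDl// lee_fin.
  by rewrite mulr_ge0 ?moment_excess_ge0// ltW.
move=> mus; have mfin := le_lt_trans mus sfin.
apply: same_measure_of_excess => n.
have [c c0 gap] := admissible_energy_gap d hH n.
have := le_trans (gap mu sfin mfin) mus.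
rewrite -[leRHS]adde0 leeD2lE ?ge0_fin_numE// lee_fin.
by rewrite pmulr_rle0.
Qed.

(** For positive exponents the power series is that of pi^delta minus the kernel,
    which turns maximizers into minimizers. *)
Lemma geodesic_energy_pos delta mu : 0 < delta < 1 ->
  (geodesic_energy delta mu =
   (pi `^ delta)%:E - \int[mu \x mu]_p (pi `^ delta - acos (D p) `^ delta)%:E)%E /\
  (\int[mu \x mu]_p (pi `^ delta - acos (D p) `^ delta)%:E)%E \is a fin_num.
Proof.
move=> d01; have hH := admissible_powP d01; have mH := @measurable_admissible R d _ _ hH.
have /andP[d0 d1] := d01.
have kE p : geodesic_kernel delta (D p) = (acos (D p) `^ delta)%:E.
  by rewrite /geodesic_kernel leNgt d0/= gt_eqF.
have mF : measurable_fun setT (fun p => (acos (D p) `^ delta)%:E).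
  apply/measurable_EFinP.
  have -> : (fun p => acos (D p) `^ delta) =
      (fun p => pi `^ delta - (pi `^ delta - acos (D p) `^ delta)).
    by apply/funext => p; rewrite subKr.
  by apply: measurable_funB => //; exact/measurable_EFinP.
have -> : geodesic_energy delta mu = (\int[mu \x mu]_p (acos (D p) `^ delta)%:E)%E.
  rewrite fubini_tonelli2//; last by move=> p; rewrite lee_fin powR_ge0.
  by apply: eq_integral => y _; apply: eq_integral => x _; rewrite -kE.
have F0 p : (0 <= (acos (D p) `^ delta)%:E)%E by rewrite lee_fin powR_ge0.
have H0 p : (0 <= (pi `^ delta - acos (D p) `^ delta)%:E)%E.
  exact/(admissible_ge0 hH)/norm_sphere_dot.
have sum : (\int[mu \x mu]_p (acos (D p) `^ delta)%:E +
    \int[mu \x mu]_p (pi `^ delta - acos (D p) `^ delta)%:E = (pi `^ delta)%:E)%E.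
  rewrite -ge0_integralD//.
  under eq_integral do rewrite -EFinD addrC subrK.
  rewrite (integral_cst (mu \x mu)%E measurableT).
  by rewrite [X in (_ * X)%E](product_probability_setT mu mu) mule1.
have fin : (\int[mu \x mu]_p (pi `^ delta - acos (D p) `^ delta)%:E)%E \is a fin_num.
  rewrite ge0_fin_numE; last exact: integral_ge0.
  apply: (@le_lt_trans _ _ (pi `^ delta)%:E); last by rewrite ltry.
  by rewrite -sum leeDr// integral_ge0.
by split=> //; rewrite -sum addeK.
Qed.

End extremality.

Unset Implicit Arguments.
Local Close Scope classical_set_scope.

Theorem theorem3p1 (R : realType) (d : nat) (hd : (1 <= d)%N) (delta : R) :
  (0 < delta < 1 ->
     unique_maximizer (@geodesic_energy R d delta) (@sigma_sphere R d)) /\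
  (- d%:R < delta <= 0 ->
     unique_minimizer (@geodesic_energy R d delta) (@sigma_sphere R d)).
Proof.
split=> dd.
- have hH := admissible_powP dd.
  pose A (mu : probability (borel_sphere R d) R) :=
    (\int[mu \x mu]_p (pi `^ delta - acos (sphere_dot p) `^ delta)%:E)%E.
  have IE mu : geodesic_energy delta mu = ((pi `^ delta)%:E - A mu)%E.
    by have [] := geodesic_energy_pos mu dd.
  have Afin mu : A mu \is a fin_num by have [] := geodesic_energy_pos mu dd.
  have Alty mu : (A mu < +oo)%E by rewrite ltey_eq Afin.
  have [le_s uniq] := admissible_extremal hH (Alty (@sigma_sphere R d)).
  split=> [mu|mu max].
    by rewrite !IE leeD2l// leeN2; exact: le_s.
  apply: uniq; have := max (@sigma_sphere R d).
  by rewrite !IE leeD2lE// leeN2.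
- have /andP[_ d0] := dd.
  have sfin := geodesic_energy_sigma_lty hd dd; rewrite geodesic_energyE// in sfin.
  have [le_s uniq] := admissible_extremal (admissible_geodesic d0) sfin.
  split=> [mu|mu min]; first by rewrite !geodesic_energyE.
  by apply: uniq; rewrite -!geodesic_energyE.
Qed.
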